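(* Let $p$ be a parabolic point of a smooth ruled surface $R$ in $\mathbb R^4\subset\mathbb RP^4$ such that the 4-jet of the Monge form of $R$ at $p$ is $(x,y,x^2+\Gamma_{40}x^4+\Gamma_{31}x^3y,\,xy+\Theta_{40}x^4)$ with $\Gamma_{31}\neq0$. Then the 5-jet of $R$ at $p$ is projectively equivalent to the 5-jet of the graph $z=g^1(x,y)$, $w=g^2(x,y)$ with $$g^1=x^2+\Gamma_{40}x^4+\Gamma_{31}x^3y+\Gamma_{50}x^5+\Gamma_{41}x^4y+\Gamma_{32}x^3y^2,$$ $$g^2=xy+\Theta_{40}x^4+\Theta_{50}x^5+\Theta_{41}x^4y$$ for some real constants $\Gamma_{50},\Gamma_{41},\Gamma_{32},\Theta_{50},\Theta_{41}$.
   Context: Ruled surface: $I\subset\mathbb R$ is an open interval, $\mathbf x:I\to\mathbb R^4$ and $\mathbf e:I\to\mathbb R^4\setminus\{0\}$ are smooth, $F(u,t)=\mathbf x(u)+t\,\mathbf e(u)$ and $R=F(I\times\mathbb R)$. Only smooth points and non-developable surfaces are considered: $\mathbf x'(u),\mathbf e(u),\mathbf e'(u)$ are linearly independent for every $u$. Monge form at $p$: in affine coordinates $(x,y,z,w)$ centred at $p$ with $T_pR$ the $xy$-plane and the ruling through $p$ equal to the $y$-axis, $R$ is the graph $z=f^1(x,y)$, $w=f^2(x,y)$ with $j^1f^i(0,0)=0$. The point $p$ is parabolic if the quadratic parts of $f^1$ and $f^2$ are linearly independent. Projective equivalence of $k$-jets: two Monge forms $(f^1,f^2)$ and $(g^1,g^2)$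 have projectively equivalent $k$-jets at the origin if there is a projective transformation preserving the origin and the $xy$-plane, i.e. a diffeomorphism-germ $\Psi=(q_1/p,q_2/p,q_3/p,q_4/p)$ of $(\mathbb R^4,0)$ with $q_1=q_{11}x+q_{12}y+q_{13}z+q_{14}w$, $q_2=q_{21}x+q_{22}y+q_{23}z+q_{24}w$, $q_3=q_{33}z+q_{34}w$, $q_4=q_{43}z+q_{44}w$, $p=1+p_1x+p_2y+p_3z+p_4w$ (real coefficients), such that $$\big(q_3/p-f^1(q_1/p,q_2/p),\ q_4/p-f^2(q_1/p,q_2/p)\big)\Big|_{z=g^1(x,y),\,w=g^2(x,y)}=o(k),$$ where $o(k)$ denotes function-germs of order greater than $k$. *)

(* Defs.v *)
From Stdlib Require Import Reals.
From Coquelicot Require Import Coquelicot.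
Open Scope R_scope.

(** * Vectors and curves in R^4 *)

(* The vector operations are Coquelicot's [plus], [scal], [zero] on products. *)
Definition R4 : Type := (R * R * R * R)%type.

Definition c1 (v : R4) : R := fst (fst (fst v)).
Definition c2 (v : R4) : R := snd (fst (fst v)).
Definition c3 (v : R4) : R := snd (fst v).
Definition c4 (v : R4) : R := snd v.

Definition lin3 (v1 v2 v3 : R4) (r1 r2 r3 : R) : R4 :=
  plus (scal r1 v1) (plus (scal r2 v2) (scal r3 v3)).

Definition lin4 (v1 v2 v3 v4 : R4) (r1 r2 r3 r4 : R) : R4 :=
  plus (scal r1 v1) (plus (scal r2 v2) (plus (scal r3 v3) (scal r4 v4))).

Definition independent3 (v1 v2 v3 : R4) : Prop :=
  forall r1 r2 r3 : R,
    lin3 v1 v2 v3 r1 r2 r3 = zero -> r1 = 0 /\ r2 = 0 /\ r3 = 0.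

Definition independent4 (v1 v2 v3 v4 : R4) : Prop :=
  forall r1 r2 r3 r4 : R,
    lin4 v1 v2 v3 v4 r1 r2 r3 r4 = zero ->
    r1 = 0 /\ r2 = 0 /\ r3 = 0 /\ r4 = 0.

Definition rbar_interval (a b : Rbar) (u : R) : Prop :=
  Rbar_lt a u /\ Rbar_lt u b.

Definition smooth_curve (I : R -> Prop) (c : R -> R4) : Prop :=
  forall (n : nat) (u : R), I u ->
    ex_derive_n (fun s => c1 (c s)) n u /\
    ex_derive_n (fun s => c2 (c s)) n u /\
    ex_derive_n (fun s => c3 (c s)) n u /\
    ex_derive_n (fun s => c4 (c s)) n u.

Definition velocity (c : R -> R4) (u : R) : R4 :=
  (Derive (fun s => c1 (c s)) u, Derive (fun s => c2 (c s)) u,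
   Derive (fun s => c3 (c s)) u, Derive (fun s => c4 (c s)) u).

(** * Ruled surfaces *)

Definition ruled_map (x e : R -> R4) (u t : R) : R4 := plus (x u) (scal t (e u)).

Definition ruled_surface (I : R -> Prop) (x e : R -> R4) : Prop :=
  smooth_curve I x /\ smooth_curve I e /\
  (forall u, I u -> e u <> zero) /\
  (forall u, I u -> independent3 (velocity x u) (e u) (velocity e u)).

(** * Germs at the origin of functions of two variables, and their jets *)

(* [ex_diff_n f n u v] is Coquelicot's "f is C^n at (u,v)". *)
Definition smooth_germ (f : R -> R -> R) : Prop :=
  locally_2d (fun u v => forall n : nat, ex_diff_n f n u v) 0 0.

(* The k-jet, as the Taylor polynomial of degree k at the origin. *)
Definition jet (k : nat) (f : R -> R -> R) (X Y : R) : R := DL_pol k f 0 0 X Y.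

(* f = o(k): every term of degree at most k of the Taylor series vanishes. *)
Definition order_gt (k : nat) (f : R -> R -> R) : Prop :=
  forall X Y : R, jet k f X Y = 0.

Definition quadratic_part (f : R -> R -> R) (X Y : R) : R :=
  differential 2 f 0 0 X Y / INR (Factorial.fact 2).

(** * Monge form *)

(* Affine coordinates on R^4: the point of coordinates (X, Y, Z, W) is
   origin + X ax_x + Y ax_y + Z ax_z + W ax_w. *)
Record affine_frame : Type := {
  origin : R4;
  ax_x : R4; ax_y : R4; ax_z : R4; ax_w : R4;
  axes_independent : independent4 ax_x ax_y ax_z ax_w
}.

Definition point_of_coords (A : affine_frame) (X Y Z W : R) : R4 :=
  plus (origin A) (lin4 (ax_x A) (ax_y A) (ax_z A) (ax_w A) X Y Z W).

(* In the coordinates A, the germ at p = F(u0,t0) of the ruled surface is the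
   graph z = f1(x,y), w = f2(x,y).  If the image of F has self-intersections at
   p, the germ meant is that of the sheet parametrized near (u0,t0). *)
Definition monge_form (I : R -> Prop) (x e : R -> R4) (u0 t0 : R)
    (A : affine_frame) (f1 f2 : R -> R -> R) : Prop :=
  let F := ruled_map x e in
  origin A = F u0 t0 /\
  (* the tangent plane at p is the xy-plane *)
  (forall v : R4,
     (exists r s : R, v = plus (scal r (velocity (fun u => F u t0) u0))
                               (scal s (velocity (fun t => F u0 t) t0))) <->
     (exists r s : R, v = plus (scal r (ax_x A)) (scal s (ax_y A)))) /\
  (* the ruling through p is the y-axis *)
  (forall P : R4,
     (exists t : R, P = F u0 t) <->
     (exists Y : R, P = point_of_coords A 0 Y 0 0)) /\
  smooth_germ f1 /\ smooth_germ f2 /\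
  order_gt 1 f1 /\ order_gt 1 f2 /\
  (exists U V : R * R -> Prop,
     open U /\ U (u0, t0) /\ (forall u t, U (u, t) -> I u) /\
     open V /\ V (0, 0) /\
     forall P : R4,
       (exists u t : R, U (u, t) /\ P = F u t) <->
       (exists X Y : R, V (X, Y) /\
          P = point_of_coords A X Y (f1 X Y) (f2 X Y))).

Definition parabolic (f1 f2 : R -> R -> R) : Prop :=
  forall r s : R,
    (forall X Y : R, r * quadratic_part f1 X Y + s * quadratic_part f2 X Y = 0) ->
    r = 0 /\ s = 0.

(** * Projective equivalence of jets *)

(* The germ (q1/p, q2/p, q3/p, q4/p) of a projective transformation fixing the
   origin and preserving the xy-plane.  Its differential at the origin is the
   matrix of (q1, q2, q3, q4), block triangular since q3 and q4 involve only z
   and w; [proj_nondegenerate] says that its determinant is nonzero, i.e. that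
   the germ is a diffeomorphism. *)
Record proj_germ : Type := {
  q11 : R; q12 : R; q13 : R; q14 : R;
  q21 : R; q22 : R; q23 : R; q24 : R;
  q33 : R; q34 : R;
  q43 : R; q44 : R;
  p1 : R; p2 : R; p3 : R; p4 : R;
  proj_nondegenerate : (q11 * q22 - q12 * q21) * (q33 * q44 - q34 * q43) <> 0
}.

Definition q1 (T : proj_germ) (x y z w : R) : R :=
  q11 T * x + q12 T * y + q13 T * z + q14 T * w.
Definition q2 (T : proj_germ) (x y z w : R) : R :=
  q21 T * x + q22 T * y + q23 T * z + q24 T * w.
Definition q3 (T : proj_germ) (x y z w : R) : R := q33 T * z + q34 T * w.
Definition q4 (T : proj_germ) (x y z w : R) : R := q43 T * z + q44 T * w.
Definition pden (T : proj_germ) (x y z w : R) : R :=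
  1 + p1 T * x + p2 T * y + p3 T * z + p4 T * w.

Definition proj_equiv_jets (k : nat) (f1 f2 g1 g2 : R -> R -> R) : Prop :=
  exists T : proj_germ,
    let on_graph (h : R -> R -> R -> R -> R) (x y : R) : R :=
      h x y (g1 x y) (g2 x y) in
    let eq1 (x y z w : R) : R :=
      q3 T x y z w / pden T x y z w
      - f1 (q1 T x y z w / pden T x y z w) (q2 T x y z w / pden T x y z w) in
    let eq2 (x y z w : R) : R :=
      q4 T x y z w / pden T x y z w
      - f2 (q1 T x y z w / pden T x y z w) (q2 T x y z w / pden T x y z w) in
    order_gt k (on_graph eq1) /\ order_gt k (on_graph eq2).

(* Main.v *)
Require Import Defs.
From Stdlib Require Import Reals Lra Lia Psatz.
From Coquelicot Require Import Coquelicot.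
Open Scope R_scope.

(** Through every point of the graph near the origin passes a line along which
    f1 and f2 are affine, so the second and third directional derivatives of
    both vanish in that direction.  Since f1 = x^2 + O(4) and f2 = xy + O(4), the
    direction is (t, 1) with t bounded by the second y-derivative of f2, which
    is O(3) because no y^2 occurs in the 4-jet of f2.  Substituting this back
    gives that f1 has second y-derivative O(4) and f2 third y-derivative O(3),
    which leaves in degree 5 only x^5, x^4 y in f1 and x^5, x^4 y, x^3 y^2 in f2.

    The projective maps x/(1+cx), y/(1+cx) of the plane lift to projective
    transformations of R^4 preserving z = x^2, w = xy.  Such a lift fixes the
    4-jet and changes the x^3 y^2 coefficient of f2 by a multiple of c G31, so
    the right c removes it. *)

(** * Functions of class C^n near a point *)

(** [ex_diff_n] is asked on a whole neighbourhood, the form in which Taylor's formula takes it; a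
    smooth germ has this property at the origin for every n. *)
Definition Cn (n : nat) (f : R -> R -> R) (x y : R) : Prop :=
  locally_2d (fun u v => ex_diff_n f n u v) x y.

Lemma locally_2d_self (P : R -> R -> Prop) x y :
  locally_2d P x y -> locally_2d (fun u v => locally_2d P u v) x y.
Proof.
  intros H. apply (locally_2d_impl_strong P); [|exact H].
  now apply locally_2d_forall.
Qed.

Lemma locally_2d_mp2 (P Q S : R -> R -> Prop) x y :
  (forall u v, P u v -> Q u v -> S u v) ->
  locally_2d P x y -> locally_2d Q x y -> locally_2d S x y.
Proof.
  intros H HP HQ.
  apply (locally_2d_impl (fun u v => P u v /\ Q u v)).
  - apply locally_2d_forall; intros u v [? ?]; auto.
  - now apply locally_2d_and.
Qed.

Lemma locally_2d_mono (P S : R -> R -> Prop) x y :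
  (forall u v, P u v -> S u v) -> locally_2d P x y -> locally_2d S x y.
Proof.
  intros H. apply locally_2d_impl. now apply locally_2d_forall.
Qed.

Lemma locally_2d_cont (P : R -> R -> Prop) (g h : R -> R -> R) x y :
  continuity_2d_pt g x y -> continuity_2d_pt h x y ->
  locally_2d P (g x y) (h x y) ->
  locally_2d (fun u v => P (g u v) (h u v)) x y.
Proof.
  intros Hg Hh [d Hd].
  apply (locally_2d_mp2 _ _ _ _ _ (fun u v A B => Hd _ _ A B) (Hg d) (Hh d)).
Qed.

Lemma Cn_le m n f x y : (m <= n)%nat -> Cn n f x y -> Cn m f x y.
Proof.
  intros H. apply locally_2d_mono. intros u v. now apply ex_diff_n_m.
Qed.

Lemma Cn_cont n f x y : Cn n f x y -> continuity_2d_pt f x y.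
Proof.
  intros H. apply locally_2d_singleton in H. destruct n; apply H.
Qed.

Lemma Cn_ext n f g x y :
  locally_2d (fun u v => f u v = g u v) x y -> Cn n f x y -> Cn n g x y.
Proof.
  intros H. apply locally_2d_impl.
  apply locally_2d_self in H. revert H. apply locally_2d_mono.
  intros u v H1. now apply ex_diff_n_ext_loc.
Qed.

Definition dx (f : R -> R -> R) (u v : R) : R := Derive (fun z => f z v) u.
Definition dy (f : R -> R -> R) (u v : R) : R := Derive (fun z => f u z) v.

Lemma Cn_dx n f x y : Cn (S n) f x y -> Cn n (dx f) x y.
Proof. apply locally_2d_mono. now intros u v (_ & _ & _ & H & _). Qed.

Lemma Cn_dy n f x y : Cn (S n) f x y -> Cn n (dy f) x y.
Proof. apply locally_2d_mono. now intros u v (_ & _ & _ & _ & H). Qed.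

Lemma Cn_ex_derive n f x y : Cn (S n) f x y ->
  ex_derive (fun z => f z y) x /\ ex_derive (fun z => f x z) y.
Proof. intros H. apply locally_2d_singleton in H. now destruct H as (_ & ? & ? & _). Qed.

(** This is the induction step for the closure lemmas below: compute the first partial derivatives
    near the point by the usual rules, then apply the induction hypothesis to the resulting
    expressions. *)
Lemma Cn_S n f x y :
  locally_2d (fun u v => continuity_2d_pt f u v /\
     ex_derive (fun z => f z v) u /\ ex_derive (fun z => f u z) v) x y ->
  Cn n (dx f) x y -> Cn n (dy f) x y -> Cn (S n) f x y.
Proof.
  intros H H1 H2. generalize (locally_2d_and _ _ _ _ H (locally_2d_and _ _ _ _ H1 H2)).
  apply locally_2d_mono. intros u v ((A & B & C) & D & E).
  simpl. repeat split; assumption.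
Qed.

(** One partial derivative that exists nearby and is continuous at the point, together with the
    other one at the point itself, gives a total derivative. *)
Lemma Cn_differentiable n f x y :
  Cn (S n) f x y -> differentiable_pt_lim f x y (dx f x y) (dy f x y).
Proof.
  intros H.
  apply filterdiff_differentiable_pt_lim.
  apply (is_derive_filterdiff f x y (dx f) (dy f x y)).
  - apply (proj1 (locally_2d_locally
      (fun u v => is_derive (fun z => f z v) u (dx f u v)) x y)).
    revert H. apply locally_2d_mono. intros u v (_ & H & _).
    now apply Derive_correct.
  - apply Derive_correct. now apply (Cn_ex_derive n).
  - apply continuity_2d_pt_filterlim. apply (Cn_cont n). now apply Cn_dx.
Qed.

(** * Closure of the class C^n under algebraic operations and composition *)

Lemma Cn_const n c x y : Cn n (fun _ _ => c) x y.
Proof.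
  revert c. induction n; intros c.
  - apply locally_2d_forall. intros u v. split; [apply continuity_2d_pt_const|easy].
  - apply Cn_S.
    + apply locally_2d_forall. intros u v.
      repeat split; [apply continuity_2d_pt_const| apply ex_derive_const..].
    + apply (Cn_ext _ (fun _ _ => 0)); [|apply IHn].
      apply locally_2d_forall. intros u v. unfold dx. now rewrite Derive_const.
    + apply (Cn_ext _ (fun _ _ => 0)); [|apply IHn].
      apply locally_2d_forall. intros u v. unfold dy. now rewrite Derive_const.
Qed.

Lemma Cn_fst n x y : Cn n (fun u _ => u) x y.
Proof.
  destruct n.
  - apply locally_2d_forall. intros u v. split; [apply continuity_2d_pt_id1|easy].
  - apply Cn_S.
    + apply locally_2d_forall. intros u v.
      repeat split; [apply continuity_2d_pt_id1|apply ex_derive_id|apply ex_derive_const].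
    + apply (Cn_ext _ (fun _ _ => 1)); [|apply Cn_const].
      apply locally_2d_forall. intros u v. unfold dx. now rewrite Derive_id.
    + apply (Cn_ext _ (fun _ _ => 0)); [|apply Cn_const].
      apply locally_2d_forall. intros u v. unfold dy. now rewrite Derive_const.
Qed.

Lemma Cn_snd n x y : Cn n (fun _ v => v) x y.
Proof.
  destruct n.
  - apply locally_2d_forall. intros u v. split; [apply continuity_2d_pt_id2|easy].
  - apply Cn_S.
    + apply locally_2d_forall. intros u v.
      repeat split; [apply continuity_2d_pt_id2|apply ex_derive_const|apply ex_derive_id].
    + apply (Cn_ext _ (fun _ _ => 0)); [|apply Cn_const].
      apply locally_2d_forall. intros u v. unfold dx. now rewrite Derive_const.
    + apply (Cn_ext _ (fun _ _ => 1)); [|apply Cn_const].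
      apply locally_2d_forall. intros u v. unfold dy. now rewrite Derive_id.
Qed.

Lemma Cn_plus n f g x y : Cn n f x y -> Cn n g x y -> Cn n (fun u v => f u v + g u v) x y.
Proof.
  revert f g. induction n; intros f g Hf Hg.
  - revert Hf Hg. apply locally_2d_mp2. intros u v [? _] [? _].
    split; [now apply continuity_2d_pt_plus|easy].
  - assert (HL := locally_2d_and _ _ _ _ Hf Hg).
    apply Cn_S.
    + revert HL. apply locally_2d_mono. intros u v ((A & B & C & _) & (D & E & F & _)).
      repeat split; [now apply continuity_2d_pt_plus|
        now apply @ex_derive_plus..].
    + apply (Cn_ext _ (fun u v => dx f u v + dx g u v)).
      * revert HL. apply locally_2d_mono. intros u v ((A & B & C & _) & (D & E & F & _)).
        symmetry. now apply Derive_plus.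
      * apply IHn; now apply Cn_dx.
    + apply (Cn_ext _ (fun u v => dy f u v + dy g u v)).
      * revert HL. apply locally_2d_mono. intros u v ((A & B & C & _) & (D & E & F & _)).
        symmetry. now apply Derive_plus.
      * apply IHn; now apply Cn_dy.
Qed.

Lemma Cn_mult n f g x y : Cn n f x y -> Cn n g x y -> Cn n (fun u v => f u v * g u v) x y.
Proof.
  revert f g. induction n; intros f g Hf Hg.
  - revert Hf Hg. apply locally_2d_mp2. intros u v [? _] [? _].
    split; [now apply continuity_2d_pt_mult|easy].
  - assert (HL := locally_2d_and _ _ _ _ Hf Hg).
    assert (Hf' := Cn_le _ _ _ _ _ (Nat.le_succ_diag_r n) Hf).
    assert (Hg' := Cn_le _ _ _ _ _ (Nat.le_succ_diag_r n) Hg).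
    apply Cn_S.
    + revert HL. apply locally_2d_mono. intros u v ((A & B & C & _) & (D & E & F & _)).
      repeat split; [now apply continuity_2d_pt_mult|
        now apply ex_derive_mult..].
    + apply (Cn_ext _ (fun u v => dx f u v * g u v + f u v * dx g u v)).
      * revert HL. apply locally_2d_mono. intros u v ((A & B & C & _) & (D & E & F & _)).
        symmetry. now apply Derive_mult.
      * apply Cn_plus; apply IHn; trivial; now apply Cn_dx.
    + apply (Cn_ext _ (fun u v => dy f u v * g u v + f u v * dy g u v)).
      * revert HL. apply locally_2d_mono. intros u v ((A & B & C & _) & (D & E & F & _)).
        symmetry. now apply Derive_mult.
      * apply Cn_plus; apply IHn; trivial; now apply Cn_dy.
Qed.

(** Continuity keeps f nonzero nearby. The derivative -f'/f^2 involves 1/f only as a factor of class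
    C^n, which the induction hypothesis provides. *)
Lemma Cn_inv n f x y : f x y <> 0 -> Cn n f x y -> Cn n (fun u v => / f u v) x y.
Proof.
  intros H0.
  induction n; intros Hf;
  assert (HL := locally_2d_and _ _ _ _ Hf (continuity_2d_pt_neq_0 _ _ _ (Cn_cont _ _ _ _ Hf) H0)).
  - revert HL. apply locally_2d_mono. intros u v [[? _] ?].
    split; [now apply continuity_2d_pt_inv|easy].
  - assert (Hi := IHn (Cn_le _ _ _ _ _ (Nat.le_succ_diag_r n) Hf)).
    apply Cn_S.
    + revert HL. apply locally_2d_mono. intros u v ((A & B & C & _) & D).
      repeat split; [now apply continuity_2d_pt_inv| now apply ex_derive_inv..].
    + apply (Cn_ext _ (fun u v => (-1) * (dx f u v * (/ f u v * / f u v)))).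
      * revert HL. apply locally_2d_mono. intros u v ((A & B & C & _) & D).
        symmetry. unfold dx at 1. rewrite Derive_inv by trivial. fold (dx f u v). now field.
      * apply Cn_mult; [apply Cn_const|]. apply Cn_mult; [now apply Cn_dx|now apply Cn_mult].
    + apply (Cn_ext _ (fun u v => (-1) * (dy f u v * (/ f u v * / f u v)))).
      * revert HL. apply locally_2d_mono. intros u v ((A & B & C & _) & D).
        symmetry. unfold dy at 1. rewrite Derive_inv by trivial.
        change (Derive (f u) v) with (dy f u v). now field.
      * apply Cn_mult; [apply Cn_const|]. apply Cn_mult; [now apply Cn_dy|now apply Cn_mult].
Qed.

(** By the chain rule the partial derivatives are sums of products containing [dx f] and [dy f]
    composed with (g, h); the induction therefore ranges over all f. *)
Lemma Cn_comp n f g h x y :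
  Cn n f (g x y) (h x y) -> Cn n g x y -> Cn n h x y ->
  Cn n (fun u v => f (g u v) (h u v)) x y.
Proof.
  revert f g h. induction n; intros f g h Hf Hg Hh;
  assert (HL := locally_2d_and _ _ _ _
     (locally_2d_cont _ _ _ _ _ (Cn_cont _ _ _ _ Hg) (Cn_cont _ _ _ _ Hh) (locally_2d_self _ _ _ Hf))
     (locally_2d_and _ _ _ _ (locally_2d_self _ _ _ Hg) (locally_2d_self _ _ _ Hh)));
  cbv beta in HL.
  - revert HL. apply locally_2d_mono. intros u v (A & B & C). split; [|easy].
    apply Cn_cont, continuity_2d_pt_filterlim in A.
    apply Cn_cont, continuity_2d_pt_filterlim in B.
    apply Cn_cont, continuity_2d_pt_filterlim in C.
    apply continuity_2d_pt_filterlim.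
    apply (filterlim_comp_2 (F:=locally (u,v)) (fun z => g (fst z) (snd z))
       (fun z => h (fst z) (snd z)) f B C).
    revert A. apply filterlim_filter_le_1.
    intros P [d Hd]. exists (fun a => Rabs (a - g u v) < d) (fun b => Rabs (b - h u v) < d).
    + now exists d.
    + now exists d.
    + intros a b Ha Hb. now apply (Hd (a, b)).
  (* Total differentiability gives continuity and the values of the partial derivatives of the
     composite; their existence, which [Cn_S] asks for as well, is [HE]. *)
  - assert (HD : locally_2d (fun u v =>
       differentiable_pt_lim (fun u v => f (g u v) (h u v)) u v
         (dx f (g u v) (h u v) * dx g u v + dy f (g u v) (h u v) * dx h u v)
         (dx f (g u v) (h u v) * dy g u v + dy f (g u v) (h u v) * dy h u v)) x y).
    { revert HL. apply locally_2d_mono. intros u v (A & B & C).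
      apply differentiable_pt_lim_comp; now apply (Cn_differentiable n). }
    assert (HE : locally_2d (fun u v => ex_derive (fun z => f (g z v) (h z v)) u /\
                   ex_derive (fun z => f (g u z) (h u z)) v) x y).
    { revert HL. apply locally_2d_mono. intros u v (A & B & C).
      apply Cn_ex_derive in B as B1. apply Cn_ex_derive in C as C1.
      apply Cn_differentiable in A. destruct B1 as [B1 B2]. destruct C1 as [C1 C2].
      split.
      - apply Derive_correct, is_derive_Reals in B1.
        apply Derive_correct, is_derive_Reals in C1.
        eexists. apply is_derive_Reals.
        exact (derivable_pt_lim_comp_2d _ _ _ _ _ _ _ _ A B1 C1).
      - apply Derive_correct, is_derive_Reals in B2.
        apply Derive_correct, is_derive_Reals in C2.
        eexists. apply is_derive_Reals.
        exact (derivable_pt_lim_comp_2d _ _ (fun z => h u z) _ _ _ _ _ A B2 C2). }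
    assert (Hg' := Cn_le _ _ _ _ _ (Nat.le_succ_diag_r n) Hg).
    assert (Hh' := Cn_le _ _ _ _ _ (Nat.le_succ_diag_r n) Hh).
    apply Cn_S.
    + generalize (locally_2d_and _ _ _ _ HD HE). apply locally_2d_mono.
      intros u v (A & B & C). repeat split; trivial.
      apply differentiable_continuity_pt. eexists; eexists; exact A.
    + apply (Cn_ext _ (fun u v => dx f (g u v) (h u v) * dx g u v
                                + dy f (g u v) (h u v) * dx h u v)).
      { revert HD. apply locally_2d_mono. intros u v A.
        symmetry. exact (proj1 (differentiable_pt_lim_unique _ _ _ _ _ A)). }
      apply Cn_plus; apply Cn_mult; try (now apply Cn_dx);
        apply (IHn _ g h); trivial; (now apply Cn_dx) || (now apply Cn_dy).
    + apply (Cn_ext _ (fun u v => dx f (g u v) (h u v) * dy g u v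
                                + dy f (g u v) (h u v) * dy h u v)).
      { revert HD. apply locally_2d_mono. intros u v A.
        symmetry. exact (proj2 (differentiable_pt_lim_unique _ _ _ _ _ A)). }
      apply Cn_plus; apply Cn_mult; try (now apply Cn_dy);
        apply (IHn _ g h); trivial; (now apply Cn_dx) || (now apply Cn_dy).
Qed.

Lemma Cn_pow n k f x y : Cn n f x y -> Cn n (fun u v => f u v ^ k) x y.
Proof.
  intros H. induction k; simpl; [apply Cn_const|now apply Cn_mult].
Qed.

Lemma Cn_minus n f g x y : Cn n f x y -> Cn n g x y -> Cn n (fun u v => f u v - g u v) x y.
Proof.
  intros Hf Hg. apply (Cn_ext _ (fun u v => f u v + (-1) * g u v)).
  - apply locally_2d_forall. intros; ring.
  - apply Cn_plus; trivial. apply Cn_mult; trivial. apply Cn_const.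
Qed.

(** * Orders of vanishing at the origin *)

(** An analytic substitute for vanishing jets: it passes through products and compositions without
    computing derivatives. The maximum norm is that of the Taylor remainder in
    [Taylor_Lagrange_2d]. *)
Definition bigO (k : nat) (f : R -> R -> R) : Prop :=
  exists C : R, locally_2d (fun u v => Rabs (f u v) <= C * Rmax (Rabs u) (Rabs v) ^ k) 0 0.

Lemma Rmax_abs_pos u v : 0 <= Rmax (Rabs u) (Rabs v).
Proof. apply Rle_trans with (Rabs u); [apply Rabs_pos|apply Rmax_l]. Qed.

Lemma locally_2d_box d : 0 < d ->
  locally_2d (fun u v => Rmax (Rabs u) (Rabs v) < d) 0 0.
Proof.
  intros Hd. exists (mkposreal d Hd). intros u v. rewrite !Rminus_0_r. simpl.
  intros. now apply Rmax_lub_lt.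
Qed.

Lemma bigO_pos k f : bigO k f ->
  exists C : R, 0 < C /\
  locally_2d (fun u v => Rabs (f u v) <= C * Rmax (Rabs u) (Rabs v) ^ k) 0 0.
Proof.
  intros [C H]. exists (Rabs C + 1). split; [generalize (Rabs_pos C); lra|].
  revert H. apply locally_2d_mono. intros u v H. apply Rle_trans with (1:=H).
  apply Rmult_le_compat_r; [apply pow_le, Rmax_abs_pos|].
  generalize (Rle_abs C); lra.
Qed.

Lemma bigO_ext k f g :
  locally_2d (fun u v => f u v = g u v) 0 0 -> bigO k f -> bigO k g.
Proof.
  intros H [C HC]. exists C. revert H HC. apply locally_2d_mp2.
  now intros u v ->.
Qed.

Lemma bigO_le m n f : (m <= n)%nat -> bigO n f -> bigO m f.
Proof.
  intros Hmn H. apply bigO_pos in H. destruct H as (C & HC & H). exists C.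
  generalize (locally_2d_box 1 Rlt_0_1). revert H. apply locally_2d_mp2.
  intros u v H1 H2. apply Rle_trans with (1:=H1). apply Rmult_le_compat_l; [lra|].
  replace n with (m + (n - m))%nat by lia. rewrite pow_add.
  rewrite <- (Rmult_1_r (_ ^ m)) at 2.
  apply Rmult_le_compat_l; [apply pow_le, Rmax_abs_pos|].
  rewrite <- (pow1 (n - m)). apply pow_incr. split; [apply Rmax_abs_pos|lra].
Qed.

Lemma bigO_plus k f g : bigO k f -> bigO k g -> bigO k (fun u v => f u v + g u v).
Proof.
  intros [C HC] [D HD]. exists (C + D). revert HC HD. apply locally_2d_mp2.
  intros u v H1 H2. apply Rle_trans with (1:=Rabs_triang _ _). lra.
Qed.

Lemma bigO_opp k f : bigO k f -> bigO k (fun u v => - f u v).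
Proof.
  intros [C HC]. exists C. revert HC. apply locally_2d_mono.
  intros u v. now rewrite Rabs_Ropp.
Qed.

Lemma bigO_minus k f g : bigO k f -> bigO k g -> bigO k (fun u v => f u v - g u v).
Proof. intros Hf Hg. apply bigO_plus; trivial. now apply bigO_opp. Qed.

Lemma bigO_mult j k f g : bigO j f -> bigO k g -> bigO (j + k) (fun u v => f u v * g u v).
Proof.
  intros [C HC] [D HD]. exists (C * D). revert HC HD. apply locally_2d_mp2.
  intros u v H1 H2. rewrite Rabs_mult, pow_add.
  replace (C * D * _) with ((C * Rmax (Rabs u) (Rabs v) ^ j) * (D * Rmax (Rabs u) (Rabs v) ^ k)) by ring.
  apply Rmult_le_compat; trivial; apply Rabs_pos.
Qed.

Lemma bigO_const c : bigO 0 (fun _ _ => c).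
Proof. exists (Rabs c). apply locally_2d_forall. intros. simpl. lra. Qed.

Lemma bigO_fst : bigO 1 (fun u _ => u).
Proof.
  exists 1. apply locally_2d_forall. intros. simpl. rewrite Rmult_1_l, Rmult_1_r. apply Rmax_l.
Qed.

Lemma bigO_snd : bigO 1 (fun _ v => v).
Proof.
  exists 1. apply locally_2d_forall. intros. simpl. rewrite Rmult_1_l, Rmult_1_r. apply Rmax_r.
Qed.

Lemma bigO_pow j k f : bigO j f -> bigO (j * k) (fun u v => f u v ^ k).
Proof.
  intros H. induction k.
  - rewrite Nat.mul_0_r. simpl. apply bigO_const.
  - rewrite Nat.mul_succ_r, Nat.add_comm. simpl. now apply bigO_mult.
Qed.

Lemma bigO_cont f : continuity_2d_pt f 0 0 -> bigO 0 f.
Proof.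
  intros H. exists (Rabs (f 0 0) + 1). generalize (H (mkposreal 1 Rlt_0_1)).
  apply locally_2d_mono. simpl. intros u v Huv.
  replace (f u v) with (f u v - f 0 0 + f 0 0) by ring.
  apply Rle_trans with (1:=Rabs_triang _ _). lra.
Qed.

Lemma bigO_small k f d : 0 < d -> bigO (S k) f -> locally_2d (fun u v => Rabs (f u v) < d) 0 0.
Proof.
  intros Hd H. apply (bigO_le 1) in H; [|lia].
  apply bigO_pos in H. destruct H as (C & HC & H).
  assert (Hp : 0 < d / C) by now apply Rdiv_lt_0_compat.
  generalize (locally_2d_box _ Hp). revert H. apply locally_2d_mp2.
  intros u v H1 H2. apply Rle_lt_trans with (1:=H1). rewrite pow_1.
  apply (Rmult_lt_compat_l C) in H2; trivial. replace (C * (d / C)) with d in H2 by (field; lra).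
  exact H2.
Qed.

(** Since g and h are small, (g, h) enters the neighbourhood where the bound on f holds, and its
    maximum norm is at most D + E times that of (u, v). *)
Lemma bigO_comp k f g h : bigO k f -> bigO 1 g -> bigO 1 h ->
  bigO k (fun u v => f (g u v) (h u v)).
Proof.
  intros Hf Hg Hh. apply bigO_pos in Hf. destruct Hf as (C & HC & [d Hd]).
  assert (Hg' := bigO_small 0 g d (cond_pos d) Hg).
  assert (Hh' := bigO_small 0 h d (cond_pos d) Hh).
  apply bigO_pos in Hg. destruct Hg as (D & HD & Hg).
  apply bigO_pos in Hh. destruct Hh as (E & HE & Hh).
  exists (C * (D + E) ^ k).
  generalize (locally_2d_and _ _ _ _ Hg Hh) (locally_2d_and _ _ _ _ Hg' Hh').
  apply locally_2d_mp2. intros u v (A1 & A2) (A3 & A4).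
  apply Rle_trans with (1 := Hd (g u v) (h u v)
    ltac:(now rewrite Rminus_0_r) ltac:(now rewrite Rminus_0_r)).
  rewrite Rmult_assoc, <- Rpow_mult_distr. apply Rmult_le_compat_l; [lra|].
  apply pow_incr. split; [apply Rmax_abs_pos|].
  rewrite pow_1 in *.
  assert (HM := Rmax_abs_pos u v).
  apply Rmax_lub; nra.
Qed.

Lemma bigO_dom k f g : locally_2d (fun u v => Rabs (f u v) <= Rabs (g u v)) 0 0 ->
  bigO k g -> bigO k f.
Proof.
  intros H [C HC]. exists C. revert H HC. apply locally_2d_mp2. intros; lra.
Qed.

Lemma bigO_abs k f : bigO k f -> bigO k (fun u v => Rabs (f u v)).
Proof.
  apply bigO_dom. apply locally_2d_forall. intros. rewrite Rabs_Rabsolu. lra.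
Qed.

Lemma bigO_scal a k f : bigO k f -> bigO k (fun x y => a * f x y).
Proof. apply (bigO_mult 0 k), bigO_const. Qed.

Lemma bigO_monomial a i j k : (k <= i + j)%nat -> bigO k (fun x y => a * x ^ i * y ^ j).
Proof.
  intros H. apply (bigO_le _ _ _ H). apply bigO_mult.
  - apply (bigO_mult 0 i); [apply bigO_const|].
    rewrite <- (Nat.mul_1_l i) at 1. apply bigO_pow, bigO_fst.
  - rewrite <- (Nat.mul_1_l j) at 1. apply bigO_pow, bigO_snd.
Qed.

(** * From orders of vanishing to vanishing Taylor coefficients *)

Lemma Rabs_le_small_0 a K d : 0 < d -> (forall s, 0 < s < d -> Rabs a <= K * s) -> a = 0.
Proof.
  intros Hd H. destruct (Req_dec a 0) as [|Ha]; trivial. exfalso.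
  apply Rabs_pos_lt in Ha.
  assert (HK : 0 < Rabs K + 1) by (generalize (Rabs_pos K); lra).
  (* For this s the hypothesis would give |a| <= |a| / 2, while d / 2 keeps s in the admissible
     range. *)
  pose (s := Rmin (d / 2) (Rabs a / 2 / (Rabs K + 1))).
  assert (Hq : 0 < Rabs a / 2 / (Rabs K + 1)) by (apply Rdiv_lt_0_compat; lra).
  assert (H1 : 0 < s) by (apply Rmin_glb_lt; lra).
  assert (H2 : s < d) by (apply Rle_lt_trans with (1:=Rmin_l _ _); lra).
  specialize (H s (conj H1 H2)).
  assert (H3 : s * (Rabs K + 1) <= Rabs a / 2).
  { apply Rle_trans with (Rabs a / 2 / (Rabs K + 1) * (Rabs K + 1)).
    - apply Rmult_le_compat_r; [lra|apply Rmin_r].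
    - right. field. lra. }
  generalize (Rle_abs K). nra.
Qed.

Lemma sum_pow_bounded (c : nat -> R) n :
  exists M, forall s, 0 <= s <= 1 -> Rabs (sum_f_R0 (fun p => c p * s ^ p) n) <= M.
Proof.
  induction n.
  - exists (Rabs (c 0%nat)). intros. simpl. right. f_equal. ring.
  - destruct IHn as [M HM]. exists (M + Rabs (c (S n))). intros s Hs.
    rewrite tech5. apply Rle_trans with (1:=Rabs_triang _ _).
    apply Rplus_le_compat; [now apply HM|].
    rewrite Rabs_mult. rewrite <- (Rmult_1_r (Rabs (c _))) at 2.
    apply Rmult_le_compat_l; [apply Rabs_pos|].
    rewrite Rabs_pos_eq by (apply pow_le; lra).
    rewrite <- (pow1 (S n)). now apply pow_incr.
Qed.

(** Letting s tend to 0 kills the constant coefficient; dividing by s then lowers both the degree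
    and the exponent of the bound by one. *)
Lemma sum_pow_bigO_0 (n : nat) : forall (c : nat -> R) K d, 0 < d ->
  (forall s, 0 < s < d -> Rabs (sum_f_R0 (fun p => c p * s ^ p) n) <= K * s ^ S n) ->
  forall p, (p <= n)%nat -> c p = 0.
Proof.
  induction n; intros c K d Hd H.
  - intros p Hp. replace p with 0%nat by lia.
    apply (Rabs_le_small_0 _ K d Hd). intros s Hs. specialize (H s Hs).
    simpl in H. now rewrite !Rmult_1_r in H.
  - assert (Hdec : forall s, sum_f_R0 (fun p => c p * s ^ p) (S n)
        = c 0%nat + s * sum_f_R0 (fun p => c (S p) * s ^ p) n).
    { intros s. rewrite decomp_sum by lia. simpl (Init.Nat.pred (S n)).
      rewrite scal_sum. simpl (s ^ 0). rewrite Rmult_1_r. f_equal.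
      apply sum_eq. intros. simpl. ring. }
    assert (H0 : c 0%nat = 0).
    { destruct (sum_pow_bounded (fun p => c (S p)) n) as [M HM].
      apply (Rabs_le_small_0 _ (Rabs K + M) (Rmin d 1)); [apply Rmin_glb_lt; lra|].
      intros s [Hs Hs1]. assert (s < d) by (apply Rlt_le_trans with (1:=Hs1), Rmin_l).
      assert (s < 1) by (apply Rlt_le_trans with (1:=Hs1), Rmin_r).
      specialize (H s (conj Hs H0)). rewrite Hdec in H.
      specialize (HM s ltac:(lra)). cbv beta in HM.
      set (S0 := sum_f_R0 _ _) in *.
      replace (c 0%nat) with (c 0%nat + s * S0 - s * S0) by ring.
      apply Rle_trans with (1:=Rabs_triang _ _).
      rewrite Rabs_Ropp, (Rabs_mult s), (Rabs_pos_eq s) by lra.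
      assert (K * s ^ S (S n) <= Rabs K * s).
      { apply Rle_trans with (Rabs K * s ^ S (S n)).
        - apply Rmult_le_compat_r; [apply pow_le; lra|apply Rle_abs].
        - apply Rmult_le_compat_l; [apply Rabs_pos|].
          rewrite <- tech_pow_Rmult. rewrite <- (Rmult_1_r s) at 3.
          apply Rmult_le_compat_l; [lra|]. rewrite <- (pow1 (S n)). apply pow_incr. lra. }
      nra. }
    intros [|p] Hp; trivial.
    apply (IHn (fun p => c (S p)) K d Hd); [|lia].
    intros s Hs. specialize (H s Hs). rewrite Hdec, H0, Rplus_0_l in H.
    rewrite Rabs_mult, (Rabs_pos_eq s) in H by lra.
    apply (Rmult_le_reg_l s); [lra|]. apply Rle_trans with (1:=H).
    right. rewrite <- (tech_pow_Rmult _ (S n)). ring.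
Qed.

Lemma differential_scal p f x y s X Y :
  differential p f x y (s * X) (s * Y) = s ^ p * differential p f x y X Y.
Proof.
  unfold differential. rewrite scal_sum. apply sum_eq. intros i Hi.
  replace (s ^ p) with (s ^ i * s ^ (p - i)) by (rewrite <- pow_add; f_equal; lia).
  rewrite !Rpow_mult_distr. ring.
Qed.

(** Along a ray the Taylor polynomial is a polynomial in s alone, so the one-variable lemmas apply
    to it. *)
Lemma DL_pol_scal n f x y s X Y :
  DL_pol n f x y (s * X) (s * Y) =
  sum_f_R0 (fun p => differential p f x y X Y / INR (Factorial.fact p) * s ^ p) n.
Proof.
  unfold DL_pol. apply sum_eq. intros i _. rewrite differential_scal. unfold Rdiv. ring.
Qed.

Lemma jet_remainder k f : Cn (S k) f 0 0 -> bigO (S k) (fun u v => f u v - jet k f u v).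
Proof.
  intros H. destruct (Taylor_Lagrange_2d f k 0 0 H) as [D HD]. exists D.
  revert HD. apply locally_2d_mono. intros u v. now rewrite !Rminus_0_r.
Qed.

(** The jet is f minus its Taylor remainder, hence O(k+1). Along each ray it is a polynomial in s of
    degree at most k bounded by a multiple of s^(k+1), so all its coefficients vanish. *)
Lemma bigO_jet_0 k f : Cn (S k) f 0 0 -> bigO (S k) f ->
  forall p, (p <= k)%nat -> forall X Y, differential p f 0 0 X Y = 0.
Proof.
  intros H1 H2 p Hp X Y. apply jet_remainder in H1.
  assert (H3 : bigO (S k) (jet k f)).
  { apply (bigO_ext _ (fun u v => f u v - (f u v - jet k f u v))).
    - apply locally_2d_forall. intros. ring.
    - now apply bigO_minus. }
  destruct H3 as [K [d H3]].
  (* The condition s r < d places (s X, s Y) in the box where the bound holds; the added 1 keeps r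
     positive when X = Y = 0. *)
  set (r := Rmax (Rabs X) (Rabs Y) + 1).
  assert (Hr : 0 < r) by (generalize (Rmax_abs_pos X Y); unfold r; lra).
  assert (E : differential p f 0 0 X Y / INR (Factorial.fact p) = 0).
  { apply (sum_pow_bigO_0 k (fun p => differential p f 0 0 X Y / INR (Factorial.fact p))
             (K * Rmax (Rabs X) (Rabs Y) ^ S k) (d / r)); trivial.
    - apply Rdiv_lt_0_compat; trivial. apply cond_pos.
    - intros s [Hs Hs']. rewrite <- DL_pol_scal.
      assert (Hsr : s * r < d).
      { apply (Rmult_lt_compat_r r) in Hs'; trivial.
        replace (d / r * r) with (pos d) in Hs' by (field; lra). exact Hs'. }
      assert (HX : Rabs X <= r) by (unfold r; generalize (Rmax_l (Rabs X) (Rabs Y)); lra).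
      assert (HY : Rabs Y <= r) by (unfold r; generalize (Rmax_r (Rabs X) (Rabs Y)); lra).
      refine (Rle_trans _ _ _ (H3 _ _ _ _) _).
      + rewrite Rminus_0_r, Rabs_mult, (Rabs_pos_eq s) by lra. nra.
      + rewrite Rminus_0_r, Rabs_mult, (Rabs_pos_eq s) by lra. nra.
      + rewrite !Rabs_mult, (Rabs_pos_eq s), RmaxRmult, Rpow_mult_distr by lra.
        right; ring. }
  apply (Rmult_eq_reg_r (/ INR (Factorial.fact p))).
  - now rewrite Rmult_0_l.
  - apply Rinv_neq_0_compat, INR_fact_neq_0.
Qed.

Lemma bigO_order_gt k f : Cn (S k) f 0 0 -> bigO (S k) f -> order_gt k f.
Proof.
  intros H1 H2 X Y. unfold jet, DL_pol. apply sum_eq_R0. intros p Hp.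
  rewrite (bigO_jet_0 k f H1 H2 p Hp). unfold Rdiv. ring.
Qed.

(** * Rulings of the surface *)

Lemma R4_ext (v w : R4) :
  Defs.c1 v = Defs.c1 w -> c2 v = c2 w -> c3 v = c3 w -> c4 v = c4 w -> v = w.
Proof.
  destruct v as [[[? ?] ?] ?], w as [[[? ?] ?] ?]. unfold Defs.c1, c2, c3, c4; simpl.
  now intros -> -> -> ->.
Qed.

Lemma c1_plus (v w : R4) : Defs.c1 (plus v w) = Defs.c1 v + Defs.c1 w. Proof. reflexivity. Qed.
Lemma c1_scal (r : R) (v : R4) : Defs.c1 (scal r v) = r * Defs.c1 v. Proof. reflexivity. Qed.
Lemma c1_zero : Defs.c1 (zero : R4) = 0. Proof. reflexivity. Qed.
Lemma c2_plus (v w : R4) : c2 (plus v w) = c2 v + c2 w. Proof. reflexivity. Qed.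
Lemma c2_scal (r : R) (v : R4) : c2 (scal r v) = r * c2 v. Proof. reflexivity. Qed.
Lemma c2_zero : c2 (zero : R4) = 0. Proof. reflexivity. Qed.
Lemma c3_plus (v w : R4) : c3 (plus v w) = c3 v + c3 w. Proof. reflexivity. Qed.
Lemma c3_scal (r : R) (v : R4) : c3 (scal r v) = r * c3 v. Proof. reflexivity. Qed.
Lemma c3_zero : c3 (zero : R4) = 0. Proof. reflexivity. Qed.
Lemma c4_plus (v w : R4) : c4 (plus v w) = c4 v + c4 w. Proof. reflexivity. Qed.
Lemma c4_scal (r : R) (v : R4) : c4 (scal r v) = r * c4 v. Proof. reflexivity. Qed.
Lemma c4_zero : c4 (zero : R4) = 0. Proof. reflexivity. Qed.

Hint Rewrite c1_plus c1_scal c1_zero c2_plus c2_scal c2_zero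
  c3_plus c3_scal c3_zero c4_plus c4_scal c4_zero : R4_coords.

Ltac R4_coords :=
  unfold point_of_coords, ruled_map, lin4 in *; autorewrite with R4_coords in *.

Ltac R4_split H :=
  generalize (f_equal Defs.c1 H) (f_equal c2 H) (f_equal c3 H) (f_equal c4 H);
  clear H; R4_coords.

Lemma point_of_coords_inj A X Y Z W X' Y' Z' W' :
  point_of_coords A X Y Z W = point_of_coords A X' Y' Z' W' ->
  X = X' /\ Y = Y' /\ Z = Z' /\ W = W'.
Proof.
  intros H.
  destruct (axes_independent A (X - X') (Y - Y') (Z - Z') (W - W')) as (?&?&?&?).
  - R4_split H. intros Q1 Q2 Q3 Q4.  apply R4_ext; R4_coords; lra.
  - repeat split; lra.
Qed.

(* The set equality in [monge_form] suffices: a point of the graph is some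
   F(u,t) with (u,t) in the open set U, and F(u,t+s) stays on the graph. *)
Lemma ruling_through (I : R -> Prop) (x e : R -> R4) u0 t0 A f1 f2 :
  (forall u, I u -> e u <> zero) ->
  monge_form I x e u0 t0 A f1 f2 ->
  locally_2d (fun X Y => exists a b c d eps, (a <> 0 \/ b <> 0) /\ 0 < eps /\
    forall s, Rabs s < eps -> f1 (X + s * a) (Y + s * b) = f1 X Y + s * c /\
                              f2 (X + s * a) (Y + s * b) = f2 X Y + s * d) 0 0.
Proof.
  intros He (_ & _ & _ & _ & _ & _ & _ & U & V & HU & _ & HUI & HV & HV0 & H).
  apply (proj2 (locally_2d_locally _ _ _)).
  apply (filter_imp V); [|now apply HV].
  intros [X Y] HXY. simpl.
  destruct (proj2 (H (point_of_coords A X Y (f1 X Y) (f2 X Y)))) as (u & t & Hut & E);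
    [now exists X, Y|].
  destruct (HU _ Hut) as [eps Heps].
  assert (Hline : forall s, Rabs s < eps -> exists X' Y',
     point_of_coords A X' Y' (f1 X' Y') (f2 X' Y') =
     plus (point_of_coords A X Y (f1 X Y) (f2 X Y)) (scal s (e u))).
  { intros s Hs.
    destruct (proj1 (H (ruled_map x e u (t + s)))) as (X' & Y' & _ & E').
    - exists u, (t + s). split; trivial. apply Heps.
      split; simpl; [apply ball_center|].
      unfold ball; simpl. unfold AbsRing_ball, abs, minus, plus, opp; simpl.
      now replace (t + s + - t) with s by ring.
    - exists X', Y'. rewrite <- E', E. apply R4_ext; R4_coords; ring. }
  (* A second point of the ruling, at parameter eps / 2, gives the coordinates of e(u) in the frame
     as difference quotients. *)
  assert (Hd : 0 < eps / 2) by (generalize (cond_pos eps); lra).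
  destruct (Hline (eps / 2)) as (X1 & Y1 & E1).
  { rewrite Rabs_pos_eq; lra. }
  set (del := eps / 2) in *.
  set (a := (X1 - X) / del). set (b := (Y1 - Y) / del).
  set (c := (f1 X1 Y1 - f1 X Y) / del). set (d := (f2 X1 Y1 - f2 X Y) / del).
  assert (Eu : e u = lin4 (ax_x A) (ax_y A) (ax_z A) (ax_w A) a b c d).
  { unfold a, b, c, d. R4_split E1. intros Q1 Q2 Q3 Q4.
    apply R4_ext; R4_coords; apply (Rmult_eq_reg_l del); try lra; field_simplify; lra. }
  exists a, b, c, d, eps. split; [|split; [apply cond_pos|]].
  (* If a = b = 0, both points of the ruling lie over the same (X, Y), so they coincide on the graph
     and e(u) would be zero. *)
  - destruct (Req_dec a 0) as [Ha|]; [|now left].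
    destruct (Req_dec b 0) as [Hb|]; [|now right].
    exfalso. apply (He u); [now apply (HUI u t)|].
    assert (HX : X1 = X) by (unfold a in Ha; apply Rmult_integral in Ha as [Ha|Ha];
      [lra|]; apply Rinv_neq_0_compat in Ha; lra).
    assert (HY : Y1 = Y) by (unfold b in Hb; apply Rmult_integral in Hb as [Hb|Hb];
      [lra|]; apply Rinv_neq_0_compat in Hb; lra).
    rewrite Eu, Ha, Hb. unfold c, d. rewrite HX, HY.
    apply R4_ext; R4_coords; unfold Rdiv; ring.
  (* Affine coordinates are unique, so the point of the ruling at parameter s is the graph point
     over (X + s a, Y + s b). *)
  - intros s Hs. destruct (Hline s Hs) as (X' & Y' & E').
    destruct (point_of_coords_inj A X' Y' (f1 X' Y') (f2 X' Y')
       (X + s * a) (Y + s * b) (f1 X Y + s * c) (f2 X Y + s * d)) as (-> & -> & -> & ->);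
      [|now split].
    rewrite E', Eu. apply R4_ext; R4_coords; ring.
Qed.

(** * Constraints on the 5-jet *)

(** On the segment, the Taylor polynomial minus the affine function is a polynomial in s of degree
    at most n that is O(s^(n+1)), hence zero; its coefficients of order at least 2 come from f
    alone. *)
Lemma differential_of_affine n f X Y a b c eps :
  Cn (S n) f X Y -> 0 < eps ->
  (forall s, Rabs s < eps -> f (X + s * a) (Y + s * b) = f X Y + s * c) ->
  forall p, (2 <= p <= n)%nat -> differential p f X Y a b = 0.
Proof.
  intros Hf Heps Haff p Hp.
  destruct (Taylor_Lagrange_2d f n X Y Hf) as [K [d Hd]].
  set (r := Rmax (Rabs a) (Rabs b) + 1).
  assert (Hr : 0 < r) by (generalize (Rmax_abs_pos a b); unfold r; lra).
  (* The coefficients of [f X Y + s * c] as a polynomial in s, padded by zeros from order 2 on. *)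
  set (aff := fun p => match p with O => f X Y | 1%nat => c | _ => 0 end).
  assert (Esum : forall s m, sum_f_R0 (fun p => aff p * s ^ p) (S m) = f X Y + s * c).
  { intros s m. induction m; [simpl; ring|]. rewrite tech5, IHm. simpl aff. ring. }
  assert (E : differential p f X Y a b / INR (Factorial.fact p) - aff p = 0).
  { apply (sum_pow_bigO_0 n (fun p => differential p f X Y a b / INR (Factorial.fact p) - aff p)
             (K * Rmax (Rabs a) (Rabs b) ^ S n) (Rmin eps (d / r))); try lia.
    - apply Rmin_glb_lt; trivial. apply Rdiv_lt_0_compat; trivial. apply cond_pos.
    - intros s [Hs Hs'].
      assert (Hs1 : s < eps) by (apply Rlt_le_trans with (1:=Hs'), Rmin_l).
      assert (Hs2 : s < d / r) by (apply Rlt_le_trans with (1:=Hs'), Rmin_r).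
      assert (Hsr : s * r < d).
      { apply (Rmult_lt_compat_r r) in Hs2; trivial.
        replace (d / r * r) with (pos d) in Hs2 by (field; lra). exact Hs2. }
      assert (HX : Rabs a <= r) by (unfold r; generalize (Rmax_l (Rabs a) (Rabs b)); lra).
      assert (HY : Rabs b <= r) by (unfold r; generalize (Rmax_r (Rabs a) (Rabs b)); lra).
      assert (Ex : X + s * a - X = s * a) by ring.
      assert (Ey : Y + s * b - Y = s * b) by ring.
      assert (T := Hd (X + s * a) (Y + s * b)). rewrite Ex, Ey in T.
      rewrite !Rabs_mult, (Rabs_pos_eq s), RmaxRmult, Rpow_mult_distr in T by lra.
      specialize (T ltac:(nra) ltac:(nra)).
      rewrite Haff, DL_pol_scal in T by (rewrite Rabs_pos_eq; lra).
      replace (sum_f_R0 (fun p0 => (_ - _) * s ^ p0) n) with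
        (- (f X Y + s * c - sum_f_R0 (fun p => differential p f X Y a b / INR (Factorial.fact p) * s ^ p) n)).
      + rewrite Rabs_Ropp. apply Rle_trans with (1:=T). right; ring.
      + destruct n as [|m]; [lia|]. rewrite <- (Esum s m), Ropp_minus_distr, <- minus_sum.
        apply sum_eq. intros; ring. }
  destruct p as [|[|p]]; try lia. simpl aff in E. rewrite Rminus_0_r in E.
  apply (Rmult_eq_reg_r (/ INR (Factorial.fact (S (S p))))).
  - now rewrite Rmult_0_l.
  - apply Rinv_neq_0_compat, INR_fact_neq_0.
Qed.

(** * Taylor polynomials and their coefficients *)

Lemma sum_pow_inj n (c c' : nat -> R) :
  (forall s, sum_f_R0 (fun p => c p * s ^ p) n = sum_f_R0 (fun p => c' p * s ^ p) n) ->
  forall p, (p <= n)%nat -> c p = c' p.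
Proof.
  intros H p Hp. apply Rminus_diag_uniq.
  apply (sum_pow_bigO_0 n (fun p => c p - c' p) 0 1 Rlt_0_1); trivial.
  intros s _. right.
  rewrite (sum_eq _ (fun p => c p * s ^ p - c' p * s ^ p)) by (intros; ring).
  rewrite minus_sum, H, Rminus_diag, Rabs_R0. ring.
Qed.

(** Graded by total degree and then by the power of X, as [DL_pol] is, so that a jet and an explicit
    polynomial compare term by term. *)
Definition poly2 (q : nat -> nat -> R) (n : nat) (X Y : R) : R :=
  sum_f_R0 (fun p => sum_f_R0 (fun m => q m (p - m)%nat * X ^ m * Y ^ (p - m)) p) n.

Lemma differential_coeff p f x y m : (m <= p)%nat ->
  Binomial.C p m * partial_derive m (p - m) f x y / INR (Factorial.fact p) =
  partial_derive m (p - m) f x y / (INR (Factorial.fact m) * INR (Factorial.fact (p - m))).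
Proof.
  intros Hm. unfold Binomial.C. field.
  repeat split; apply INR_fact_neq_0.
Qed.

Lemma jet_poly2 n f X Y :
  jet n f X Y = poly2 (fun m k => partial_derive m k f 0 0 /
     (INR (Factorial.fact m) * INR (Factorial.fact k))) n X Y.
Proof.
  unfold jet, DL_pol, poly2. apply sum_eq. intros p _.
  unfold differential, Rdiv at 1. rewrite Rmult_comm, scal_sum. apply sum_eq. intros m Hm.
  rewrite <- differential_coeff by trivial. unfold Rdiv. ring.
Qed.

(** Scaling (X, 1) by s isolates the homogeneous part of degree m + k, which is then a polynomial in
    X whose coefficients can be compared. *)
Lemma poly2_inj n q q' : (forall X Y, poly2 q n X Y = poly2 q' n X Y) ->
  forall m k, (m + k <= n)%nat -> q m k = q' m k.
Proof.
  intros H m k Hmk.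
  assert (Hs : forall q X Y s, poly2 q n (s * X) (s * Y) =
    sum_f_R0 (fun p => sum_f_R0 (fun m => q m (p - m)%nat * X ^ m * Y ^ (p - m)) p * s ^ p) n).
  { intros r X Y s. apply sum_eq. intros p _.
    rewrite (Rmult_comm _ (s ^ p)), scal_sum. apply sum_eq. intros i Hi.
    replace (s ^ p) with (s ^ i * s ^ (p - i)) by (rewrite <- pow_add; f_equal; lia).
    rewrite !Rpow_mult_distr. ring. }
  assert (Hh : forall X, sum_f_R0 (fun i => q i (m + k - i)%nat * X ^ i) (m + k) =
                         sum_f_R0 (fun i => q' i (m + k - i)%nat * X ^ i) (m + k)).
  { intros X.
    assert (E := sum_pow_inj n _ _ (fun s => eq_trans (eq_sym (Hs q X 1 s))
       (eq_trans (H _ _) (Hs q' X 1 s))) (m + k)%nat Hmk).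
    cbv beta in E.
    rewrite (sum_eq _ (fun i => q i (m + k - i)%nat * X ^ i * 1 ^ (m + k - i)))
      by (intros; rewrite pow1; ring).
    rewrite E. apply sum_eq. intros; rewrite pow1; ring. }
  assert (E := sum_pow_inj _ _ _ Hh m ltac:(lia)). cbv beta in E.
  now replace (m + k - m)%nat with k in E by lia.
Qed.

Lemma jet_coeff n f q : (forall X Y, jet n f X Y = poly2 q n X Y) ->
  forall m k, (m + k <= n)%nat ->
  partial_derive m k f 0 0 = q m k * (INR (Factorial.fact m) * INR (Factorial.fact k)).
Proof.
  intros H m k Hmk.
  rewrite <- (poly2_inj n (fun m k => partial_derive m k f 0 0 /
     (INR (Factorial.fact m) * INR (Factorial.fact k))) q) with (m := m) (k := k); trivial.
  - field. split; apply INR_fact_neq_0.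
  - intros X Y. rewrite <- jet_poly2. apply H.
Qed.

Lemma order_gt_partial n f : order_gt n f ->
  forall m k, (m + k <= n)%nat -> partial_derive m k f 0 0 = 0.
Proof.
  intros H m k Hmk. rewrite (jet_coeff n f (fun _ _ => 0)) by
    (trivial; intros X Y; rewrite H; symmetry; apply sum_eq_R0; intros;
     apply sum_eq_R0; intros; ring).
  ring.
Qed.

Lemma partial_order_gt n f :
  (forall m k, (m + k <= n)%nat -> partial_derive m k f 0 0 = 0) -> order_gt n f.
Proof.
  intros H X Y. rewrite jet_poly2. apply sum_eq_R0. intros. apply sum_eq_R0. intros.
  rewrite H by lia. unfold Rdiv. ring.
Qed.

Lemma Cn_partial n p q f x y : Cn (n + (p + q)) f x y -> Cn n (partial_derive p q f) x y.
Proof.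
  apply locally_2d_mono. intros u v H.
  apply (ex_diff_n_deriv _ p q) in H; [|lia].
  now replace (n + (p + q) - (p + q))%nat with n in H by lia.
Qed.

(** * Directions in which the second differentials vanish *)

Lemma differential_2 f x y a b : differential 2 f x y a b =
  partial_derive 2 0 f x y * a ^ 2 + 2 * partial_derive 1 1 f x y * a * b
  + partial_derive 0 2 f x y * b ^ 2.
Proof. unfold differential, Binomial.C. simpl sum_f_R0. simpl Factorial.fact. simpl INR. simpl Nat.sub. field. Qed.

Lemma differential_3 f x y a b : differential 3 f x y a b =
  partial_derive 3 0 f x y * a ^ 3 + 3 * partial_derive 2 1 f x y * a ^ 2 * b
  + 3 * partial_derive 1 2 f x y * a * b ^ 2 + partial_derive 0 3 f x y * b ^ 3.
Proof. unfold differential, Binomial.C. simpl sum_f_R0. simpl Factorial.fact. simpl INR. simpl Nat.sub. field. Qed.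

(* The first equation makes [t] small, which excludes the root of the second
   one near [- 2 * B2 / A2]. *)
Lemma common_root_bound A1 B1 C1 A2 B2 C2 M t :
  1 <= M -> 1 <= A1 -> Rabs B1 <= / (16 * M ^ 2) -> Rabs C1 <= / (16 * M ^ 2) ->
  Rabs A2 <= M -> 3 / 4 <= B2 ->
  A1 * t ^ 2 + 2 * B1 * t + C1 = 0 -> A2 * t ^ 2 + 2 * B2 * t + C2 = 0 ->
  Rabs t <= Rabs C2.
Proof.
  intros HM HA1 HB1 HC1 HA2 HB2 E1 E2.
  (* With this d the bound on B1 and C1 is d^2 / 4, and |t| <= d will give |A2 t| <= 1 / 2. *)
  set (d := / (2 * M)).
  assert (HdM : d * M = 1 / 2) by (unfold d; field; lra).
  assert (Hd : 0 < d) by (unfold d; apply Rinv_0_lt_compat; lra).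
  assert (Hd1 : d <= 1 / 2) by nra.
  replace (/ (16 * M ^ 2)) with (d ^ 2 / 4) in * by (unfold d; field; lra).
  assert (Ht2 : t ^ 2 = Rabs t ^ 2) by (symmetry; apply pow2_abs).
  assert (Ht : Rabs t <= d).
  (* If |t| > d, the first equation gives t^2 <= d^2 |t| / 2 + d^2 / 4; both terms are at most t^2 /
     4, because d <= 1 / 2, which is absurd. *)
  { apply Rnot_lt_le. intros Hlt.
    assert (Q : t ^ 2 <= 2 * (Rabs B1 * Rabs t) + Rabs C1).
    { apply Rle_trans with (A1 * t ^ 2); [generalize (pow2_ge_0 t); nra|].
      replace (A1 * t ^ 2) with (- (2 * (B1 * t) + C1)) by lra.
      rewrite <- Rabs_mult. generalize (Rle_abs (- (B1 * t))) (Rle_abs (- C1)).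
      rewrite !Rabs_Ropp. lra. }
    rewrite Ht2 in Q.
    assert (Rabs B1 * Rabs t <= d ^ 2 / 4 * Rabs t) by (apply Rmult_le_compat_r; [apply Rabs_pos|lra]).
    assert (d ^ 2 <= Rabs t / 2) by nra.
    assert (d ^ 2 * Rabs t <= Rabs t / 2 * Rabs t) by (apply Rmult_le_compat_r; lra).
    assert (d ^ 2 < Rabs t ^ 2) by nra.
    generalize (pow2_ge_0 d). lra. }
  (* The second equation reads C2 = - (A2 t + 2 B2) t, and the factor in parentheses is at least 3/2
     - 1/2 = 1. *)
  assert (Q : Rabs (A2 * t) <= 1 / 2).
  { rewrite Rabs_mult. apply Rle_trans with (M * d); [|lra].
    apply Rmult_le_compat; trivial; apply Rabs_pos. }
  replace C2 with (- ((A2 * t + 2 * B2) * t)) by lra.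
  rewrite Rabs_Ropp, Rabs_mult.
  assert (1 <= Rabs (A2 * t + 2 * B2)).
  { generalize (Rle_abs (A2 * t + 2 * B2)) (Rle_abs (- (A2 * t))). rewrite Rabs_Ropp. lra. }
  generalize (Rabs_pos t). nra.
Qed.

Lemma cont_near f d : continuity_2d_pt f 0 0 -> 0 < d ->
  locally_2d (fun u v => Rabs (f u v - f 0 0) < d) 0 0.
Proof. intros H Hd. exact (H (mkposreal d Hd)). Qed.

Lemma bigO_of_partials k f : Cn (S k) f 0 0 ->
  (forall m j, (m + j <= k)%nat -> partial_derive m j f 0 0 = 0) -> bigO (S k) f.
Proof.
  intros H H0. apply partial_order_gt in H0.
  apply (bigO_ext _ (fun u v => f u v - jet k f u v)).
  - apply locally_2d_forall. intros. rewrite H0. ring.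
  - now apply jet_remainder.
Qed.

(** At the origin the second differential of f1 is 2 a^2, and by continuity the coefficients nearby
    stay in the range of [common_root_bound]. The second conclusion rules out directions parallel to
    the x-axis, so a ruling direction can be scaled to (t, 1). *)
Lemma asymptotic_slope f1 f2 :
  Cn 2 f1 0 0 -> Cn 2 f2 0 0 ->
  partial_derive 2 0 f1 0 0 = 2 -> partial_derive 1 1 f1 0 0 = 0 ->
  partial_derive 0 2 f1 0 0 = 0 -> partial_derive 1 1 f2 0 0 = 1 ->
  locally_2d (fun X Y => forall t,
    differential 2 f1 X Y t 1 = 0 -> differential 2 f2 X Y t 1 = 0 ->
    Rabs t <= Rabs (partial_derive 0 2 f2 X Y)) 0 0 /\
  locally_2d (fun X Y => forall a, differential 2 f1 X Y a 0 = 0 -> a = 0) 0 0.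
Proof.
  intros S1 S2 A1 B1 C1 B2.
  assert (L1 := cont_near _ 1 (Cn_cont 0 _ _ _ (Cn_partial 0 2 0 f1 _ _ S1)) ltac:(lra)).
  split.
  (* M bounds the second x-derivative of f2 wherever it is within 1 of its value at the origin. *)
  - set (M := Rabs (partial_derive 2 0 f2 0 0) + 1).
    assert (HM : 1 <= M) by (unfold M; generalize (Rabs_pos (partial_derive 2 0 f2 0 0)); lra).
    assert (He : 0 < / (16 * M ^ 2)) by (apply Rinv_0_lt_compat; nra).
    assert (L2 := cont_near _ _ (Cn_cont 0 _ _ _ (Cn_partial 0 1 1 f1 _ _ S1)) He).
    assert (L3 := cont_near _ _ (Cn_cont 0 _ _ _ (Cn_partial 0 0 2 f1 _ _ S1)) He).
    assert (L4 := cont_near _ 1 (Cn_cont 0 _ _ _ (Cn_partial 0 2 0 f2 _ _ S2)) ltac:(lra)).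
    assert (L5 := cont_near _ (1 / 4) (Cn_cont 0 _ _ _ (Cn_partial 0 1 1 f2 _ _ S2)) ltac:(lra)).
    generalize (locally_2d_and _ _ _ _ L1 (locally_2d_and _ _ _ _ L2 L3))
               (locally_2d_and _ _ _ _ L4 L5).
    apply locally_2d_mp2. intros X Y (P1 & P2 & P3) (P4 & P5) t E1 E2.
    rewrite differential_2 in E1, E2.
    rewrite A1 in P1. rewrite B1, Rminus_0_r in P2. rewrite C1, Rminus_0_r in P3.
    rewrite B2 in P5. apply Rabs_def2 in P1. apply Rabs_def2 in P5.
    apply (common_root_bound (partial_derive 2 0 f1 X Y) (partial_derive 1 1 f1 X Y)
      (partial_derive 0 2 f1 X Y) (partial_derive 2 0 f2 X Y) (partial_derive 1 1 f2 X Y)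
      (partial_derive 0 2 f2 X Y) M t HM); try lra.
    replace (partial_derive 2 0 f2 X Y) with
      (partial_derive 2 0 f2 X Y - partial_derive 2 0 f2 0 0 + partial_derive 2 0 f2 0 0) by ring.
    apply Rle_trans with (1:=Rabs_triang _ _). unfold M. lra.
  - revert L1. apply locally_2d_mono. intros X Y P1 a E. rewrite differential_2 in E.
    rewrite A1 in P1. apply Rabs_def2 in P1.
    destruct (Req_dec a 0) as [|Ha]; trivial.
    apply pow2_gt_0 in Ha. nra.
Qed.

(** The shifts k + 2 and k + 3 select derivatives with at least two or three differentiations in y.
    From such information on f2 up to order 4, the rulings yield the conclusions up to order 5. *)
Lemma ruled_jet_vanishing f1 f2 :
  smooth_germ f1 -> smooth_germ f2 ->
  locally_2d (fun X Y => exists a b c d eps, (a <> 0 \/ b <> 0) /\ 0 < eps /\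
    forall s, Rabs s < eps -> f1 (X + s * a) (Y + s * b) = f1 X Y + s * c /\
                              f2 (X + s * a) (Y + s * b) = f2 X Y + s * d) 0 0 ->
  partial_derive 2 0 f1 0 0 = 2 -> partial_derive 1 1 f1 0 0 = 0 ->
  partial_derive 0 2 f1 0 0 = 0 -> partial_derive 1 1 f2 0 0 = 1 ->
  (forall m k, (m + k <= 2)%nat -> partial_derive m (k + 2) f2 0 0 = 0) ->
  (forall m k, (m + k <= 3)%nat -> partial_derive m (k + 2) f1 0 0 = 0) /\
  (forall m k, (m + k <= 2)%nat -> partial_derive m (k + 3) f2 0 0 = 0).
Proof.
  intros S1 S2 L A1 B1 C1 B2 V2.
  assert (T1 : forall n, Cn n f1 0 0) by (intros n; revert S1; apply locally_2d_mono; auto).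
  assert (T2 : forall n, Cn n f2 0 0) by (intros n; revert S2; apply locally_2d_mono; auto).
  assert (P1 : forall n p q, Cn n (partial_derive p q f1) 0 0) by (intros; apply Cn_partial, T1).
  assert (P2 : forall n p q, Cn n (partial_derive p q f2) 0 0) by (intros; apply Cn_partial, T2).
  assert (O0 : forall p q, bigO 0 (partial_derive p q f1) /\ bigO 0 (partial_derive p q f2)).
  { intros p q. split; apply bigO_cont; [apply (Cn_cont _ _ _ _ (P1 0%nat p q))|
      apply (Cn_cont _ _ _ _ (P2 0%nat p q))]. }
  assert (HL : locally_2d (fun X Y => exists t,
     Rabs t <= Rabs (partial_derive 0 2 f2 X Y) /\
     differential 2 f1 X Y t 1 = 0 /\ differential 3 f2 X Y t 1 = 0) 0 0).
  { destruct (asymptotic_slope f1 f2 (T1 2%nat) (T2 2%nat) A1 B1 C1 B2) as [Q1 Q2].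
    generalize (locally_2d_and _ _ _ _ L (locally_2d_and _ _ _ _ Q1 Q2))
      (locally_2d_and _ _ _ _ (locally_2d_self _ _ _ (T1 4%nat)) (locally_2d_self _ _ _ (T2 4%nat))).
    apply locally_2d_mp2.
    intros X Y ((a & b & c & d & eps & Hab & Heps & H) & H1 & H2) (HC1 & HC2).
    assert (D1 := differential_of_affine 3 f1 X Y a b c eps HC1 Heps (fun s Hs => proj1 (H s Hs))).
    assert (D2 := differential_of_affine 3 f2 X Y a b d eps HC2 Heps (fun s Hs => proj2 (H s Hs))).
    (* The ruling is not parallel to the x-axis, so homogeneity of the differentials allows b to be
       scaled to 1. *)
    destruct (Req_dec b 0) as [Hb|Hb].
    { subst b. destruct Hab as [Ha|]; [|easy]. destruct Ha. apply H2, D1. lia. }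
    assert (Hsc : forall p f, differential p f X Y a b = 0 -> differential p f X Y (a / b) 1 = 0).
    { intros p f E.
      replace (differential p f X Y a b) with (differential p f X Y (b * (a / b)) (b * 1)) in E
        by (f_equal; now field).
      rewrite differential_scal in E. apply Rmult_integral in E as [E|E]; trivial.
      now apply pow_nonzero with (n := p) in Hb. }
    exists (a / b).
    repeat split; [apply H1| |]; apply Hsc; (apply D1 || apply D2); lia. }
  (* By [V2] this function has zero derivatives up to order 2 at the origin. As it bounds |t|, the
     slope of the rulings is O(3). *)
  assert (O3 : bigO 3 (partial_derive 0 2 f2)).
  { apply bigO_of_partials; [apply P2|]. intros m k Hmk.
    rewrite partial_derive_add_zero by auto. rewrite Nat.add_0_r. now apply V2. }
  assert (O1 : bigO 1 (partial_derive 1 1 f1)).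
  { apply bigO_of_partials; [apply P1|]. intros m k Hmk.
    assert (m = 0%nat) as -> by lia. assert (k = 0%nat) as -> by lia. exact B1. }
  split.
  (* The vanishing second differential of f1 expresses its second y-derivative as t times (t times a
     bounded term plus twice the mixed derivative). The bracket is O(1) and |t| is bounded by an
     O(3) function. *)
  - assert (O4 : bigO 4 (partial_derive 0 2 f1)).
    { apply (bigO_dom _ _ (fun X Y => partial_derive 0 2 f2 X Y *
         (Rabs (partial_derive 0 2 f2 X Y) * Rabs (partial_derive 2 0 f1 X Y) +
          2 * Rabs (partial_derive 1 1 f1 X Y)))).
      - revert HL. apply locally_2d_mono. intros X Y (t & Ht & E & _).
        rewrite differential_2 in E.
        replace (partial_derive 0 2 f1 X Y) with
          (- (t * (t * partial_derive 2 0 f1 X Y + 2 * partial_derive 1 1 f1 X Y))) by lra.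
        rewrite Rabs_Ropp, !Rabs_mult.
        apply Rmult_le_compat; [apply Rabs_pos..|exact Ht|].
        refine (Rle_trans _ _ _ _ (Rle_abs _)).
        apply Rle_trans with (1:=Rabs_triang _ _). rewrite !Rabs_mult, (Rabs_pos_eq 2) by lra.
        apply Rplus_le_compat_r, Rmult_le_compat_r; [apply Rabs_pos|exact Ht].
      - apply (bigO_mult 3 1); trivial. apply bigO_plus.
        + apply (bigO_le _ (3 + 0)); [lia|]. apply bigO_mult; apply bigO_abs; [trivial|apply O0].
        + apply (bigO_mult 0 1); [apply bigO_const|now apply bigO_abs]. }
    intros m k Hmk.
    assert (Z := order_gt_partial _ _ (bigO_order_gt 3 _ (P1 4%nat 0%nat 2%nat) O4) m k Hmk).
    rewrite partial_derive_add_zero in Z by auto. now rewrite Nat.add_0_r in Z.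
  (* The vanishing third differential of f2 expresses its third y-derivative as t times bounded
     terms. *)
  - assert (O4 : bigO 3 (partial_derive 0 3 f2)).
    { apply (bigO_dom _ _ (fun X Y => partial_derive 0 2 f2 X Y *
         ((Rabs (partial_derive 0 2 f2 X Y) * Rabs (partial_derive 0 2 f2 X Y)) * Rabs (partial_derive 3 0 f2 X Y) +
          3 * (Rabs (partial_derive 0 2 f2 X Y) * Rabs (partial_derive 2 1 f2 X Y)) +
          3 * Rabs (partial_derive 1 2 f2 X Y)))).
      - revert HL. apply locally_2d_mono. intros X Y (t & Ht & _ & E).
        rewrite differential_3 in E.
        replace (partial_derive 0 3 f2 X Y) with
          (- (t * ((t * t) * partial_derive 3 0 f2 X Y + 3 * (t * partial_derive 2 1 f2 X Y)
                   + 3 * partial_derive 1 2 f2 X Y))) by lra.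
        rewrite Rabs_Ropp, !Rabs_mult.
        apply Rmult_le_compat; [apply Rabs_pos..|exact Ht|].
        refine (Rle_trans _ _ _ _ (Rle_abs _)).
        apply Rle_trans with (1:=Rabs_triang _ _).
        rewrite Rabs_mult, (Rabs_pos_eq 3) by lra. apply Rplus_le_compat_r.
        apply Rle_trans with (1:=Rabs_triang _ _).
        rewrite !Rabs_mult, (Rabs_pos_eq 3) by lra.
        apply Rplus_le_compat.
        + apply Rmult_le_compat_r; [apply Rabs_pos|]. apply Rmult_le_compat; trivial; apply Rabs_pos.
        + apply Rmult_le_compat_l; [lra|]. apply Rmult_le_compat_r; [apply Rabs_pos|exact Ht].
      - assert (O2 : bigO 0 (fun X Y => Rabs (partial_derive 0 2 f2 X Y))) by (apply bigO_abs, O0).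
        apply (bigO_mult 3 0); trivial. repeat apply bigO_plus.
        + apply (bigO_mult 0 0); [apply (bigO_mult 0 0); trivial|apply bigO_abs, O0].
        + apply (bigO_mult 0 0); [apply bigO_const|]. apply (bigO_mult 0 0); [trivial|apply bigO_abs, O0].
        + apply (bigO_mult 0 0); [apply bigO_const|]. apply bigO_abs, O0. }
    intros m k Hmk.
    assert (Z := order_gt_partial _ _ (bigO_order_gt 2 _ (P2 3%nat 0%nat 3%nat) O4) m k Hmk).
    rewrite partial_derive_add_zero in Z by auto. now rewrite Nat.add_0_r in Z.
Qed.

(** * Shape of the 5-jet of the Monge form *)

Lemma order_gt_ext k f g : (forall x y, f x y = g x y) -> order_gt k f -> order_gt k g.
Proof.
  intros H Hf X Y. rewrite <- (Hf X Y), !jet_poly2.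
  apply sum_eq. intros p _. apply sum_eq. intros m _. do 3 f_equal.
  apply partial_derive_ext_loc, locally_2d_forall. intros; now rewrite H.
Qed.

Lemma jet_S k f X Y : jet (S k) f X Y =
  jet k f X Y + differential (S k) f 0 0 X Y / INR (Factorial.fact (S k)).
Proof. reflexivity. Qed.

Lemma differential_5 f X Y : differential 5 f 0 0 X Y / INR (Factorial.fact 5) =
  partial_derive 5 0 f 0 0 / 120 * X ^ 5 + partial_derive 4 1 f 0 0 / 24 * X ^ 4 * Y
  + partial_derive 3 2 f 0 0 / 12 * X ^ 3 * Y ^ 2 + partial_derive 2 3 f 0 0 / 12 * X ^ 2 * Y ^ 3
  + partial_derive 1 4 f 0 0 / 24 * X * Y ^ 4 + partial_derive 0 5 f 0 0 / 120 * Y ^ 5.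
Proof.
  unfold differential, Binomial.C. cbn [sum_f_R0 Nat.sub].
  replace (INR (Factorial.fact 5)) with 120 by (simpl; ring).
  replace (INR (Factorial.fact 4)) with 24 by (simpl; ring).
  replace (INR (Factorial.fact 3)) with 6 by (simpl; ring).
  replace (INR (Factorial.fact 2)) with 2 by (simpl; ring).
  replace (INR (Factorial.fact 1)) with 1 by (simpl; ring).
  replace (INR (Factorial.fact 0)) with 1 by (simpl; ring).
  field.
Qed.

Lemma ruled_5_jets (I : R -> Prop) (x e : R -> R4) u0 t0 A f1 f2 G40 G31 T40 :
  (forall u, I u -> e u <> zero) ->
  monge_form I x e u0 t0 A f1 f2 ->
  (forall X Y : R, jet 4 f1 X Y = X ^ 2 + G40 * X ^ 4 + G31 * X ^ 3 * Y) ->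
  (forall X Y : R, jet 4 f2 X Y = X * Y + T40 * X ^ 4) ->
  exists F50 F41 H50 H41 H32,
    (forall X Y, jet 5 f1 X Y = X ^ 2 + G40 * X ^ 4 + G31 * X ^ 3 * Y
       + F50 * X ^ 5 + F41 * X ^ 4 * Y) /\
    (forall X Y, jet 5 f2 X Y = X * Y + T40 * X ^ 4
       + H50 * X ^ 5 + H41 * X ^ 4 * Y + H32 * X ^ 3 * Y ^ 2).
Proof.
  intros He HM J1 J2.
  assert (L := ruling_through _ _ _ _ _ _ _ _ He HM).
  destruct HM as (_ & _ & _ & S1 & S2 & _).
  (* The matches tabulate the coefficients of X^m Y^k in the given 4-jets, with default 0. *)
  assert (K1 := jet_coeff 4 f1 (fun m k => match m, k with
    | 2%nat, 0%nat => 1 | 4%nat, 0%nat => G40 | 3%nat, 1%nat => G31 | _, _ => 0 end)).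
  assert (K2 := jet_coeff 4 f2 (fun m k => match m, k with
    | 1%nat, 1%nat => 1 | 4%nat, 0%nat => T40 | _, _ => 0 end)).
  specialize (K1 ltac:(intros X Y; rewrite J1; unfold poly2; cbn [sum_f_R0 Nat.sub]; ring)).
  specialize (K2 ltac:(intros X Y; rewrite J2; unfold poly2; cbn [sum_f_R0 Nat.sub]; ring)).
  destruct (ruled_jet_vanishing f1 f2 S1 S2 L) as [V1 V2].
  - rewrite K1 by lia. simpl. ring.
  - rewrite K1 by lia. simpl. ring.
  - rewrite K1 by lia. simpl. ring.
  - rewrite K2 by lia. simpl. ring.
  - intros m k Hmk. rewrite K2 by lia.
    destruct m as [|[|[|m]]], k as [|[|[|k]]]; lia || (simpl; ring).
  - exists (partial_derive 5 0 f1 0 0 / 120), (partial_derive 4 1 f1 0 0 / 24),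
      (partial_derive 5 0 f2 0 0 / 120), (partial_derive 4 1 f2 0 0 / 24),
      (partial_derive 3 2 f2 0 0 / 12).
    split; intros X Y; rewrite jet_S, differential_5.
    + rewrite J1, (V1 3%nat 0%nat ltac:(lia) : partial_derive 3 2 f1 0 0 = 0),
        (V1 2%nat 1%nat ltac:(lia) : partial_derive 2 3 f1 0 0 = 0),
        (V1 1%nat 2%nat ltac:(lia) : partial_derive 1 4 f1 0 0 = 0),
        (V1 0%nat 3%nat ltac:(lia) : partial_derive 0 5 f1 0 0 = 0).
      unfold Rdiv. ring.
    + rewrite J2, (V2 2%nat 0%nat ltac:(lia) : partial_derive 2 3 f2 0 0 = 0),
        (V2 1%nat 1%nat ltac:(lia) : partial_derive 1 4 f2 0 0 = 0),
        (V2 0%nat 2%nat ltac:(lia) : partial_derive 0 5 f2 0 0 = 0).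
      unfold Rdiv. ring.
Qed.

(** * The projective transformation *)

Section Transformation.

Variables (f1 f2 : R -> R -> R) (G40 G31 T40 F50 F41 H50 H41 H32 : R).
Hypotheses (S1 : smooth_germ f1) (S2 : smooth_germ f2).
Hypothesis J1 : forall X Y, jet 5 f1 X Y =
  X ^ 2 + G40 * X ^ 4 + G31 * X ^ 3 * Y + F50 * X ^ 5 + F41 * X ^ 4 * Y.
Hypothesis J2 : forall X Y, jet 5 f2 X Y =
  X * Y + T40 * X ^ 4 + H50 * X ^ 5 + H41 * X ^ 4 * Y + H32 * X ^ 3 * Y ^ 2.
Hypothesis G31_neq_0 : G31 <> 0.

(* [T50] and [T41] absorb what the transformation adds to the coefficients of
   x^5 and x^4 y; the coefficient [H32 + c * G31] of x^3 y^2 vanishes. *)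
Let c := - H32 / G31.
Let T50 := H50 - c * T40.
Let T41 := H41 + c * G40.
(** [zeta] and [omega] measure how far the target graph departs from the model surface z = x^2, w =
    x y; both are O(4). *)
Let zeta x y := G40 * x ^ 4 + G31 * x ^ 3 * y + F50 * x ^ 5 + F41 * x ^ 4 * y.
Let omega x y := T40 * x ^ 4 + T50 * x ^ 5 + T41 * x ^ 4 * y.
Let g1 x y := x ^ 2 + zeta x y.
Let g2 x y := x * y + omega x y.
(** [den], [n1] and [n2] are 1 + 2 c x + c^2 z, x + c z and y + c w restricted to the graph. On the
    model surface [den] is (1 + c x)^2, so X and Y become x / (1 + c x) and y / (1 + c x). *)
Let den x y := 1 + 2 * c * x + c ^ 2 * g1 x y.
Let n1 x y := x + c * g1 x y.
Let n2 x y := y + c * g2 x y.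
Let X x y := n1 x y * / den x y.
Let Y x y := n2 x y * / den x y.

(** * Regularity and order of the components of the transformation *)

Ltac cn := repeat first [apply Cn_minus | apply Cn_plus | apply Cn_mult | apply Cn_pow
  | apply Cn_const | apply Cn_fst | apply Cn_snd].

Lemma den_00 : den 0 0 = 1.
Proof. unfold den, g1, zeta. ring. Qed.

Lemma Cn_den n : Cn n den 0 0.
Proof. unfold den, g1, zeta. cn. Qed.

Lemma Cn_iden n : Cn n (fun x y => / den x y) 0 0.
Proof. apply Cn_inv; [rewrite den_00; lra|apply Cn_den]. Qed.

Lemma Cn_g1 n : Cn n g1 0 0.
Proof. unfold g1, zeta. cn. Qed.

Lemma Cn_g2 n : Cn n g2 0 0.
Proof. unfold g2, omega. cn. Qed.

Lemma Cn_X n : Cn n X 0 0.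
Proof.
  apply Cn_mult; [|apply Cn_iden]. apply Cn_plus; [apply Cn_fst|].
  apply Cn_mult; [apply Cn_const|apply Cn_g1].
Qed.

Lemma Cn_Y n : Cn n Y 0 0.
Proof.
  apply Cn_mult; [|apply Cn_iden]. apply Cn_plus; [apply Cn_snd|].
  apply Cn_mult; [apply Cn_const|apply Cn_g2].
Qed.

Lemma bigO_zeta : bigO 4 zeta.
Proof.
  apply (bigO_ext _ (fun x y => G40 * x ^ 4 * y ^ 0 + G31 * x ^ 3 * y ^ 1
     + F50 * x ^ 5 * y ^ 0 + F41 * x ^ 4 * y ^ 1)).
  - apply locally_2d_forall. intros. unfold zeta. ring.
  - repeat apply bigO_plus; apply bigO_monomial; lia.
Qed.

Lemma bigO_omega : bigO 4 omega.
Proof.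
  apply (bigO_ext _ (fun x y => T40 * x ^ 4 * y ^ 0 + T50 * x ^ 5 * y ^ 0 + T41 * x ^ 4 * y ^ 1)).
  - apply locally_2d_forall. intros. unfold omega. ring.
  - repeat apply bigO_plus; apply bigO_monomial; lia.
Qed.

Lemma bigO_g1 : bigO 2 g1.
Proof.
  apply bigO_plus; [apply (bigO_pow 1 2), bigO_fst|].
  apply (bigO_le _ 4); [lia|apply bigO_zeta].
Qed.

Lemma bigO_g2 : bigO 2 g2.
Proof.
  apply bigO_plus; [apply (bigO_mult 1 1); [apply bigO_fst|apply bigO_snd]|].
  apply (bigO_le _ 4); [lia|apply bigO_omega].
Qed.

Lemma bigO_iden : bigO 0 (fun x y => / den x y).
Proof. apply bigO_cont, (Cn_cont 0), Cn_iden. Qed.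

Lemma den_neq_0 : locally_2d (fun x y => den x y <> 0) 0 0.
Proof.
  apply continuity_2d_pt_neq_0; [apply (Cn_cont 0), Cn_den|rewrite den_00; lra].
Qed.

Lemma bigO_X : bigO 1 (fun x y => X x y).
Proof.
  apply (bigO_mult 1 0); [|apply bigO_iden]. apply bigO_plus; [apply bigO_fst|].
  apply (bigO_le _ 2); [lia|]. apply (bigO_mult 0 2); [apply bigO_const|apply bigO_g1].
Qed.

Lemma bigO_Y : bigO 1 (fun x y => Y x y).
Proof.
  apply (bigO_mult 1 0); [|apply bigO_iden]. apply bigO_plus; [apply bigO_snd|].
  apply (bigO_le _ 2); [lia|]. apply (bigO_mult 0 2); [apply bigO_const|apply bigO_g2].
Qed.

(** * Comparison of the transformed coordinates with x and y *)

Lemma X_approx : bigO 2 (fun x y => x - X x y).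
Proof.
  apply (bigO_ext _ (fun x y => / den x y *
     (2 * c * x ^ 2 * y ^ 0 + (c ^ 2 * x ^ 1 * y ^ 0 - c * x ^ 0 * y ^ 0) * g1 x y))).
  - generalize den_neq_0. apply locally_2d_mono. intros x y H.
    unfold X, n1. apply (Rmult_eq_reg_l (den x y)); trivial. field_simplify; trivial.
    unfold den. ring.
  - apply (bigO_mult 0 2); [apply bigO_iden|]. apply bigO_plus; [apply bigO_monomial; lia|].
    apply (bigO_mult 0 2); [|apply bigO_g1]. apply bigO_minus; apply bigO_monomial; lia.
Qed.

Lemma Y_approx : bigO 2 (fun x y => y - Y x y).
Proof.
  apply (bigO_ext _ (fun x y => / den x y *
     (2 * c * x ^ 1 * y ^ 1 + c ^ 2 * x ^ 0 * y ^ 1 * g1 x y - c * x ^ 0 * y ^ 0 * g2 x y))).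
  - generalize den_neq_0. apply locally_2d_mono. intros x y H.
    unfold Y, n2. apply (Rmult_eq_reg_l (den x y)); trivial. field_simplify; trivial.
    unfold den. ring.
  - apply (bigO_mult 0 2); [apply bigO_iden|].
    apply bigO_minus; [apply bigO_plus; [apply bigO_monomial; lia|]|];
      (apply (bigO_mult 0 2); [apply bigO_monomial; lia|apply bigO_g1 || apply bigO_g2]).
Qed.

(** The difference vanishes on the model surface, so after clearing [den] every term contains
    [zeta], which is O(4), times a factor that is O(1). *)
Lemma dXX_approx : bigO 5 (fun x y => x ^ 2 - den x y * X x y ^ 2).
Proof.
  apply (bigO_ext _ (fun x y => / den x y * (zeta x y *
     (c ^ 2 * x ^ 2 * y ^ 0 - 2 * c * x ^ 1 * y ^ 0 - 2 * c ^ 2 * x ^ 2 * y ^ 0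
       - c ^ 2 * x ^ 0 * y ^ 0 * zeta x y)))).
  - generalize den_neq_0. apply locally_2d_mono. intros x y H.
    unfold X, n1. apply (Rmult_eq_reg_l (den x y)); trivial. field_simplify; trivial.
    unfold den, g1. ring.
  - apply (bigO_mult 0 5); [apply bigO_iden|]. apply (bigO_mult 4 1); [apply bigO_zeta|].
    repeat apply bigO_minus; try (apply bigO_monomial; lia).
    apply (bigO_le _ 4); [lia|]. apply (bigO_mult 0 4); [apply bigO_monomial; lia|apply bigO_zeta].
Qed.

(** By the same mechanism, every term contains [zeta] or [omega] together with a factor that is
    O(1). *)
Lemma dXY_approx : bigO 5 (fun x y => x * y - den x y * (X x y * Y x y)).
Proof.
  apply (bigO_ext _ (fun x y => / den x y *
     (zeta x y * (c ^ 2 * x ^ 1 * y ^ 1 - c * x ^ 0 * y ^ 1 - c ^ 2 * x ^ 1 * y ^ 1)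
       - omega x y * (c * x ^ 1 * y ^ 0 + c ^ 2 * x ^ 2 * y ^ 0 + c ^ 2 * x ^ 0 * y ^ 0 * zeta x y)))).
  - generalize den_neq_0. apply locally_2d_mono. intros x y H.
    unfold X, Y, n1, n2. apply (Rmult_eq_reg_l (den x y)); trivial. field_simplify; trivial.
    unfold den, g1, g2. ring.
  - apply (bigO_mult 0 5); [apply bigO_iden|]. apply bigO_minus.
    + apply (bigO_mult 4 1); [apply bigO_zeta|].
      repeat apply bigO_minus; apply bigO_monomial; lia.
    + apply (bigO_mult 4 1); [apply bigO_omega|].
      repeat apply bigO_plus; try (apply bigO_monomial; lia).
      apply (bigO_le _ 4); [lia|]. apply (bigO_mult 0 4); [apply bigO_monomial; lia|apply bigO_zeta].
Qed.

(* Unlike [X] and [Y] themselves, these agree with x^2 and x y up to O(5): on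
   the model surface z = x^2, w = x y the agreement is exact. *)
Let A x y := den x y * X x y ^ 2.
Let B x y := den x y * (X x y * Y x y).

Lemma bigO_A : bigO 2 A.
Proof. apply (bigO_mult 0 2); [apply bigO_cont, (Cn_cont 0), Cn_den|apply (bigO_pow 1 2), bigO_X]. Qed.

Lemma bigO_B : bigO 2 B.
Proof.
  apply (bigO_mult 0 2); [apply bigO_cont, (Cn_cont 0), Cn_den|].
  apply (bigO_mult 1 1); [apply bigO_X|apply bigO_Y].
Qed.

(** With 1 / den^2 factored out, X^4, X^3 Y, X^5, X^4 Y and X^3 Y^2 become A^2, A B, A^2 X, A^2 Y
    and A B Y. This lemma and the next four replace them by monomials in x and y. *)
Lemma AA_approx : bigO 6 (fun x y => x ^ 4 - A x y ^ 2).
Proof.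
  apply (bigO_ext _ (fun x y => (x ^ 2 - A x y) * (x ^ 2 + A x y))).
  - apply locally_2d_forall. intros; ring.
  - apply (bigO_le _ 7); [lia|]. apply (bigO_mult 5 2); [apply dXX_approx|].
    apply bigO_plus; [apply (bigO_pow 1 2), bigO_fst|apply bigO_A].
Qed.

Lemma AB_approx : bigO 6 (fun x y => x ^ 3 * y - A x y * B x y).
Proof.
  apply (bigO_ext _ (fun x y => (x ^ 2 - A x y) * B x y + (x * y - B x y) * x ^ 2)).
  - apply locally_2d_forall. intros; ring.
  - apply (bigO_le _ 7); [lia|]. apply bigO_plus; apply (bigO_mult 5 2);
      [apply dXX_approx|apply bigO_B|apply dXY_approx|apply (bigO_pow 1 2), bigO_fst].
Qed.

Lemma AAX_approx : bigO 6 (fun x y => x ^ 5 - A x y ^ 2 * X x y).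
Proof.
  apply (bigO_ext _ (fun x y => (x ^ 4 - A x y ^ 2) * X x y + x ^ 4 * (x - X x y))).
  - apply locally_2d_forall. intros; ring.
  - apply bigO_plus.
    + apply (bigO_le _ 7); [lia|]. apply (bigO_mult 6 1); [apply AA_approx|apply bigO_X].
    (* The crude estimate of x - X to O(2) suffices beside the factor x^4. *)
    + apply (bigO_mult 4 2); [apply (bigO_pow 1 4), bigO_fst|apply X_approx].
Qed.

Lemma AAY_approx : bigO 6 (fun x y => x ^ 4 * y - A x y ^ 2 * Y x y).
Proof.
  apply (bigO_ext _ (fun x y => (x ^ 4 - A x y ^ 2) * Y x y + x ^ 4 * (y - Y x y))).
  - apply locally_2d_forall. intros; ring.
  - apply bigO_plus.
    + apply (bigO_le _ 7); [lia|]. apply (bigO_mult 6 1); [apply AA_approx|apply bigO_Y].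
    + apply (bigO_mult 4 2); [apply (bigO_pow 1 4), bigO_fst|apply Y_approx].
Qed.

Lemma ABY_approx : bigO 6 (fun x y => x ^ 3 * y ^ 2 - A x y * B x y * Y x y).
Proof.
  apply (bigO_ext _ (fun x y => (x ^ 3 * y - A x y * B x y) * Y x y
     + (1 * x ^ 3 * y ^ 1) * (y - Y x y))).
  - apply locally_2d_forall. intros; ring.
  - apply bigO_plus.
    + apply (bigO_le _ 7); [lia|]. apply (bigO_mult 6 1); [apply AB_approx|apply bigO_Y].
    + apply (bigO_mult 4 2); [apply bigO_monomial; lia|apply Y_approx].
Qed.

(** * The two graph equations modulo O(6) *)

Lemma remainder_comp f : smooth_germ f ->
  bigO 6 (fun x y => f (X x y) (Y x y) - jet 5 f (X x y) (Y x y)).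
Proof.
  intros Sf. apply (bigO_comp 6 (fun u v => f u v - jet 5 f u v) X Y);
    [|apply bigO_X|apply bigO_Y].
  apply jet_remainder. revert Sf. apply locally_2d_mono. auto.
Qed.

Lemma iden2_bigO k f : bigO k f -> bigO k (fun x y => (/ den x y) ^ 2 * f x y).
Proof. apply (bigO_mult 0 k), (bigO_pow 0 2), bigO_iden. Qed.

Lemma bigO_eq1 : bigO 6 (fun x y => g1 x y / den x y - f1 (X x y) (Y x y)).
Proof.
  apply (bigO_ext _ (fun x y => (/ den x y) ^ 2 *
      (G40 * (x ^ 4 - A x y ^ 2) + G31 * (x ^ 3 * y - A x y * B x y)
       + F50 * (x ^ 5 - A x y ^ 2 * X x y) + F41 * (x ^ 4 * y - A x y ^ 2 * Y x y))
    - (f1 (X x y) (Y x y) - jet 5 f1 (X x y) (Y x y)))).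
  - generalize den_neq_0. apply locally_2d_mono. intros x y H. rewrite J1.
    (* The identity z (1 + 2 c x + c^2 z) = (x + c z)^2 + z - x^2 makes the quadratic term X^2
       cancel exactly, leaving zeta / den^2 against the terms of degree 4 and 5. *)
    assert (E : g1 x y = (n1 x y ^ 2 + zeta x y) / den x y)
      by (apply (Rmult_eq_reg_r (den x y)); trivial; field_simplify; trivial;
          unfold n1, den, g1; ring).
    rewrite E. unfold A, B, X, Y, zeta. field. exact H.
  - apply bigO_minus; [|now apply remainder_comp]. apply iden2_bigO.
    repeat apply bigO_plus; apply bigO_scal;
      [apply AA_approx|apply AB_approx|apply AAX_approx|apply AAY_approx].
Qed.

Lemma bigO_eq2 : bigO 6 (fun x y => g2 x y / den x y - f2 (X x y) (Y x y)).
Proof.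
  apply (bigO_ext _ (fun x y => (/ den x y) ^ 2 *
      (T40 * (x ^ 4 - A x y ^ 2) + H50 * (x ^ 5 - A x y ^ 2 * X x y)
       + H41 * (x ^ 4 * y - A x y ^ 2 * Y x y) + H32 * (x ^ 3 * y ^ 2 - A x y * B x y * Y x y)
       + c * T50 * x ^ 6 * y ^ 0 + c * (T41 - F50) * x ^ 5 * y ^ 1 + - c * F41 * x ^ 4 * y ^ 2)
    - (f2 (X x y) (Y x y) - jet 5 f2 (X x y) (Y x y)))).
  - generalize den_neq_0. apply locally_2d_mono. intros x y H. rewrite J2.
    (* Here n1 n2 / den^2 is X Y and cancels. In degree 5 the rest has coefficients T50 + c T40, T41
       - c G40 and - c G31, which are H50, H41 and H32; the products of higher degree are the three
       explicit monomials of degree 6. *)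
    assert (E : g2 x y = (n1 x y * n2 x y + (1 + c * x) * omega x y - c * y * zeta x y) / den x y)
      by (apply (Rmult_eq_reg_r (den x y)); trivial; field_simplify; trivial;
          unfold n1, n2, den, g1, g2; ring).
    assert (EH : H32 = - c * G31) by (unfold c; now field).
    rewrite E. unfold A, B, X, Y, zeta, omega, T50, T41. rewrite EH. field. exact H.
  - apply bigO_minus; [|now apply remainder_comp]. apply iden2_bigO.
    repeat apply bigO_plus; try (apply bigO_monomial; lia); apply bigO_scal;
      [apply AA_approx|apply AAX_approx|apply AAY_approx|apply ABY_approx].
Qed.

(** [bigO_order_gt] needs class C^6 besides the estimate. X and Y vanish at the origin, so f is
    evaluated where its germ is smooth. *)
Lemma Cn_eq f g n : smooth_germ f -> (forall n, Cn n g 0 0) ->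
  Cn n (fun x y => g x y / den x y - f (X x y) (Y x y)) 0 0.
Proof.
  intros Sf Sg. apply Cn_minus.
  - apply Cn_mult; [apply Sg|apply Cn_iden].
  - apply Cn_comp; [|apply Cn_X|apply Cn_Y].
    assert (X 0 0 = 0) as -> by (unfold X, n1, g1, zeta; ring).
    assert (Y 0 0 = 0) as -> by (unfold Y, n2, g2, omega; ring).
    revert Sf. apply locally_2d_mono. auto.
Qed.

Lemma normal_form : exists G50 G41 G32 T50 T41 : R,
    proj_equiv_jets 5 f1 f2
      (fun X Y => X ^ 2 + G40 * X ^ 4 + G31 * X ^ 3 * Y
                  + G50 * X ^ 5 + G41 * X ^ 4 * Y + G32 * X ^ 3 * Y ^ 2)
      (fun X Y => X * Y + T40 * X ^ 4 + T50 * X ^ 5 + T41 * X ^ 4 * Y).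
Proof.
  (* The transformation leaves the 5-jet of f1 unchanged, so its x^3 y^2 coefficient stays 0. *)
  exists F50, F41, 0, T50, T41.
  assert (N : (1 * 1 - 0 * 0) * (1 * 1 - 0 * 0) <> 0) by lra.
  (* The germ has q1 = x + c z, q2 = y + c w, q3 = z, q4 = w and p = 1 + 2 c x + c^2 z. *)
  exists (Build_proj_germ 1 0 c 0 0 1 0 c 1 0 0 1 (2 * c) 0 (c ^ 2) 0 N).
  cbv zeta. unfold q1, q2, q3, q4, pden.
  cbn [q11 q12 q13 q14 q21 q22 q23 q24 q33 q34 q43 q44 p1 p2 p3 p4].
  split.
  - apply (order_gt_ext _ (fun x y => g1 x y / den x y - f1 (X x y) (Y x y))).
    + intros x y. unfold X, Y, n1, n2, den, g1, g2, zeta, omega, Rdiv.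
      repeat (f_equal; try ring).
    + apply bigO_order_gt; [apply Cn_eq; [exact S1|apply Cn_g1]|apply bigO_eq1].
  - apply (order_gt_ext _ (fun x y => g2 x y / den x y - f2 (X x y) (Y x y))).
    + intros x y. unfold X, Y, n1, n2, den, g1, g2, zeta, omega, Rdiv.
      repeat (f_equal; try ring).
    + apply bigO_order_gt; [apply Cn_eq; [exact S2|apply Cn_g2]|apply bigO_eq2].
Qed.

End Transformation.

Theorem corollary4p2 (a b : Rbar) (x e : R -> R4) (u0 t0 : R)
    (A : affine_frame) (f1 f2 : R -> R -> R) (G40 G31 T40 : R) :
  ruled_surface (rbar_interval a b) x e ->
  rbar_interval a b u0 ->
  monge_form (rbar_interval a b) x e u0 t0 A f1 f2 ->
  parabolic f1 f2 ->
  (forall X Y : R, jet 4 f1 X Y = X ^ 2 + G40 * X ^ 4 + G31 * X ^ 3 * Y) ->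
  (forall X Y : R, jet 4 f2 X Y = X * Y + T40 * X ^ 4) ->
  G31 <> 0 ->
  exists G50 G41 G32 T50 T41 : R,
    proj_equiv_jets 5 f1 f2
      (fun X Y => X ^ 2 + G40 * X ^ 4 + G31 * X ^ 3 * Y
                  + G50 * X ^ 5 + G41 * X ^ 4 * Y + G32 * X ^ 3 * Y ^ 2)
      (fun X Y => X * Y + T40 * X ^ 4 + T50 * X ^ 5 + T41 * X ^ 4 * Y).
Proof.
  intros (_ & _ & He & _) _ HM _ J1 J2 HG.
  destruct (ruled_5_jets _ _ _ _ _ _ _ _ _ _ _ He HM J1 J2)
    as (F50 & F41 & H50 & H41 & H32 & K1 & K2).
  destruct HM as (_ & _ & _ & S1 & S2 & _).
  exact (normal_form f1 f2 _ _ _ _ _ _ _ _ S1 S2 K1 K2 HG).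
Qed.
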